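(* Let $Y$ be a connected, locally path connected, first countable, Hausdorff topological space and let $S\subset Y$ be a skeletal subset such that $Y\setminus S$ is semi-locally simply connected. Every covering $X\to Y$ possibly branched over $S$ is isomorphic to the completion of the spread $H\backslash\mathrm{Ord}(\widetilde Y^S)\to Y$ for some subgroup $H$ of $\Gamma(\widetilde Y^S/Y)$. Moreover, this subgroup $H$ is normal in $\Gamma(\widetilde Y^S/Y)$ if and only if $X\to Y$ is quasi-Galoisian.
   Context: All topological spaces are Hausdorff, locally path connected and first countable. A subset $D$ of a space $X$ is locally connected in $X$ if $U\cap D$ is connected for every open connected $U\subset X$. A subset is portly in $X$ if it is open, dense and locally connected in $X$; a subset is skeletal if its complement is portly. A spread $p:X\to Y$ is a continuous map such that the connected components of preimages $p^{-1}(U)$ of open subsets $U\subset Y$ generate the topology of $X$. It is complete if for every $y\in\overline{p(X)}$ and every inclusion-increasing assignment $\chi$ associating to each open connected neighborhood $U$ of $y$ a connected component $\chi(U)$ of $p^{-1}(U)$, one has $\bigcap_U\chi(U)\neq\emptyset$. A completion of a spread $X\to Y$ is a complete spread $X'\to Y$ with an embedding $X\to X'$ over $Y$ whose image is open, dense and locally connected in $X'$; every spread has a completion, unique up to isomorphism. The ordinary locus $\mathrm{Ord}(Y)$ is the set of $y\in Y$ having an open neighborhood $U$ such that each connected component of $p^{-1}(U)$ is mapped homeomorphically onto $U$ by $p$, and $\mathrm{Ord}(X)=p^{-1}(\mathrm{Ord}(Y))$. A branched covering is a complete surjective spread $X\to Y$ with $X,Y$ connected and $\mathrm{Ord}(X)$,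 $\mathrm{Ord}(Y)$ portly in $X$, $Y$. A ''covering possibly branched over $S$'' is a branched covering with $Y\setminus\mathrm{Ord}(Y)\subset S$. Isomorphism of branched coverings of $Y$ means homeomorphism of total spaces commuting with the projections to $Y$. $\Gamma(X/Y)$ denotes the group of homeomorphisms $\varphi$ of $X$ with $p\circ\varphi=p$. A branched covering $p:X\to Y$ is Galoisian if $\Gamma(X/Y)$ acts transitively on the fibers of $p$, and quasi-Galoisian if it is the completion of a Galoisian covering (i.e. of the spread $X_1\to Y$ given by a Galoisian covering $X_1\to Y_1$ of a portly subset $Y_1\subset Y$). A space $Z$ is semi-locally simply connected if every point $z$ has a neighborhood $U$ such that every loop in $U$ based at $z$ is null-homotopic in $Z$. The universal covering $\widetilde Y^S\to Y$ possibly branched over $S$ is the completion of the spread $\widetilde{Y\setminus S}\to Y$, where $\widetilde{Y\setminus S}$ is the universal covering of $Y\setminus S$. $\mathrm{Ord}(\widetilde Y^S)$ is the ordinary locus in the total space of $\widetilde Y^S\to Y$. *)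

(* Defs.v *)
From HB Require Import structures.
From mathcomp Require Import all_boot all_order all_algebra.
From mathcomp Require Import all_classical all_reals topology normedtype.
From mathcomp Require Import homotopy.
Import Order.TTheory GRing.Theory Num.Theory numFieldNormedType.Exports.

Set Implicit Arguments.
Unset Strict Implicit.
Unset Printing Implicit Defensive.

Local Open Scope classical_set_scope.
Local Open Scope quotient_scope.
Local Open Scope ring_scope.

Definition unit_interval (R : realType) : Type :=
  set_type (`[0, 1]%classic : set R).

Section unit_interval.
Variable R : realType.
Local Notation J := (unit_interval R).

Fact unit_interval_mem0 : (0 : R) \in (`[0, 1]%classic : set R).
Proof. by rewrite inE /= in_itv /= lexx ler01. Qed.

Fact unit_interval_mem1 : (1 : R) \in (`[0, 1]%classic : set R).
Proof. by rewrite inE /= in_itv /= lexx ler01. Qed.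

Definition unit_interval0 : J := exist _ 0 unit_interval_mem0.
Definition unit_interval1 : J := exist _ 1 unit_interval_mem1.

HB.instance Definition _ :=
  Topological.copy J (set_type (`[0, 1]%classic : set R)).

Fact unit_interval_neq : unit_interval0 != unit_interval1.
Proof. by rewrite -val_eqE /= eq_sym oner_eq0. Qed.

HB.instance Definition _ := isBiPointed.Build J unit_interval_neq.
End unit_interval.

Section paths.
Variables (R : realType) (T : topologicalType).
Local Notation J := (unit_interval R).

Definition path_connected (A : set T) := forall x y, A x -> A y ->
  exists g : {path J from x to y in T}, range g `<=` A.

Definition null_homotopic (x : T) (g : {path J from x to x in T}) :=
  exists2 h : J * J -> T, continuous h &
    [/\ forall t, h (t, zero) = g t, forall t, h (t, one) = x,
        forall s, h (zero, s) = x & forall s, h (one, s) = x].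

Definition semi_locally_simply_connected := forall x : T,
  exists2 U, nbhs x U & forall g : {path J from x to x in T},
    range g `<=` U -> null_homotopic g.

Definition simply_connected :=
  path_connected [set: T] /\
  forall (x : T) (g : {path J from x to x in T}), null_homotopic g.

Definition locally_path_connected :=
  basis [set U : set T | open U /\ path_connected U].

Definition first_countable := forall x : T, exists B : set (set T),
  [/\ countable B, B `<=` nbhs x & filter_from B id --> x].

(* Spreads and coverings are only considered between admissible spaces. *)
Definition admissible_space :=
  [/\ hausdorff_space T, locally_path_connected & first_countable].

End paths.

(* The condition on images of open sets is the continuity of the inverse
   bijection B -> A for the induced topologies; stating it without the inverse
   makes sense for empty A and B too. *)
Definition homeomorphism_on (T U : topologicalType) (A : set T) (B : set U)
    (f : T -> U) :=
  [/\ set_bij A B f, {within A, continuous f} &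
      forall O, open O -> exists2 V, open V & f @` (A `&` O) = B `&` V].

Definition homeomorphism (T U : topologicalType) (f : T -> U) :=
  homeomorphism_on [set: T] [set: U] f.

Definition embedding (T U : topologicalType) (f : T -> U) :=
  homeomorphism_on [set: T] (range f) f.

Definition isomorphic_over (X X' Y : topologicalType) (p : X -> Y)
    (p' : X' -> Y) :=
  exists2 f : X -> X', homeomorphism f & p' \o f = p.

Section portly.
Variable T : topologicalType.

Definition locally_connected_in (D : set T) :=
  forall U, open U -> connected U -> connected (U `&` D).

Definition portly (D : set T) :=
  [/\ open D, dense D & locally_connected_in D].

Definition skeletal (S : set T) := portly (~` S).

Definition is_component (A C : set T) :=
  exists2 x, A x & C = connected_component A x.

End portly.

Section spreads.
Variables (R : realType) (X Y : topologicalType) (p : X -> Y).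

Definition components_over : set (set X) :=
  [set C | exists2 U, open U & is_component (p @^-1` U) C].

(* "Generating the topology" means being a subbasis. *)
Definition spread :=
  [/\ admissible_space R X, admissible_space R Y, continuous p &
      basis (finI_from components_over id)].

Definition connected_open_nbhs (y : Y) (U : set Y) :=
  open_nbhs y U /\ connected U.

Definition complete_spread := spread /\
  forall y, closure (range p) y -> forall chi : set Y -> set X,
    (forall U, connected_open_nbhs y U ->
      is_component (p @^-1` U) (chi U)) ->
    (forall U V, connected_open_nbhs y U -> connected_open_nbhs y V ->
      U `<=` V -> chi U `<=` chi V) ->
    \bigcap_(U in connected_open_nbhs y) chi U !=set0.

Definition ordinary_base : set Y :=
  [set y | exists2 U, open_nbhs y U &
    forall C, is_component (p @^-1` U) C -> homeomorphism_on C U p].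

Definition ordinary : set X := p @^-1` ordinary_base.

Definition branched_covering :=
  [/\ complete_spread, range p = [set: Y],
      connected [set: X] /\ connected [set: Y] &
      portly ordinary /\ portly ordinary_base].

Definition branched_covering_over (S : set Y) :=
  branched_covering /\ ~` ordinary_base `<=` S.

(* Components of preimages are the sheets: X is locally connected, so they are
   open, and evenly covered neighborhoods may be taken connected. *)
Definition covering :=
  [/\ admissible_space R X, admissible_space R Y, continuous p,
      range p = [set: Y] & ordinary_base = [set: Y]].

Definition universal_covering := covering /\ simply_connected R X.

End spreads.

Definition is_completion (R : realType) (X X' Y : topologicalType)
    (p : X -> Y) (p' : X' -> Y) :=
  [/\ spread R p, complete_spread R p' &
      exists i : X -> X', [/\ embedding i, p' \o i = p & portly (range i)]].

Record deck (X Y : topologicalType) (p : X -> Y) := Deck {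
  deck_map :> X -> X;
  deck_homeo : homeomorphism deck_map;
  deck_over : p \o deck_map = p
}.

Section deck_group.
Variables (X Y : topologicalType) (p : X -> Y).

Lemma deck_eqP (f g : deck p) : deck_map f =1 deck_map g -> f = g.
Proof.
case: f g => [f fh fo] [g gh go] /= /funext fg.
by move: fh fo; rewrite fg => fh fo; congr Deck; exact: Prop_irrelevance.
Qed.

Lemma homeomorphismP (f : X -> X) : homeomorphism f <->
  exists g, [/\ cancel f g, cancel g f, continuous f & continuous g].
Proof.
split=> [[[_ finj fsurj] fc fo]|[g [fK gK fc gc]]].
  have /choice [g gK] : forall y, exists x, f x = y.
    by move=> y; have [x _ <-] := fsurj y I; exists x.
  have fK : cancel f g by move=> x; apply: finj; rewrite ?inE.
  exists g; split=> //; first exact/continuous_subspace_setT.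
  apply/continuousP => A oA; have [V oV] := fo _ oA.
  rewrite !setTI => fAV; rewrite (_ : _ @^-1` _ = V)//.
  rewrite -fAV; apply/seteqP; split=> [y Agy|_ [x Ax <-]] /=.
    by exists (g y).
  by rewrite fK.
split.
- split.
  + by move=> x.
  + by move=> x y _ _ /(congr1 g); rewrite !fK.
  + by move=> y _; exists (g y); rewrite ?gK.
- exact: continuous_subspaceT.
- move=> A oA; exists (g @^-1` A); first by move/continuousP: gc; exact.
  rewrite !setTI; apply/seteqP; split=> [_ [x Ax <-]|y Agy] /=.
    by rewrite fK.
  by exists (g y).
Qed.

Definition deck_one : deck p.
Proof.
apply: (@Deck _ _ _ idfun) => //.
by apply/homeomorphismP; exists idfun; split=> // x; exact: cvg_id.
Defined.

Definition deck_mul (f g : deck p) : deck p.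
Proof.
apply: (@Deck _ _ _ (deck_map f \o deck_map g)); last first.
  by rewrite compA !deck_over.
have /homeomorphismP[f' [fK f'K fc f'c]] := deck_homeo f.
have /homeomorphismP[g' [gK g'K gc g'c]] := deck_homeo g.
apply/homeomorphismP; exists (g' \o f'); split.
- exact: can_comp.
- exact: can_comp.
- by move=> x; apply: continuous_comp; [exact: gc|exact: fc].
- by move=> x; apply: continuous_comp; [exact: f'c|exact: g'c].
Defined.

Lemma deck_inv_subproof (f : deck p) :
  exists g : deck p, cancel f g /\ cancel g f.
Proof.
have /homeomorphismP[g [fK gK fc gc]] := deck_homeo f.
have gh : homeomorphism g by apply/homeomorphismP; exists f.
have go : p \o g = p.
  by apply/funext => x; rewrite /= -[in LHS](deck_over f) /= gK.
by exists (Deck gh go).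
Qed.

Definition deck_inv (f : deck p) : deck p := sval (cid (deck_inv_subproof f)).

Lemma deck_mapK (f : deck p) : cancel f (deck_inv f).
Proof. by rewrite /deck_inv; case: cid => g []. Qed.

Lemma deck_invK (f : deck p) : cancel (deck_inv f) f.
Proof. by rewrite /deck_inv; case: cid => g []. Qed.

HB.instance Definition _ := gen_eqMixin (deck p).
HB.instance Definition _ := gen_choiceMixin (deck p).

Fact deck_mulA : associative deck_mul.
Proof. by move=> f g h; exact: deck_eqP. Qed.
Fact deck_mul1g : left_id deck_one deck_mul.
Proof. by move=> f; exact: deck_eqP. Qed.
Fact deck_mulg1 : right_id deck_one deck_mul.
Proof. by move=> f; exact: deck_eqP. Qed.
Fact deck_mulVg : left_inverse deck_one deck_inv deck_mul.
Proof. by move=> f; apply: deck_eqP => x /=; rewrite deck_mapK. Qed.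
Fact deck_mulgV : right_inverse deck_one deck_inv deck_mul.
Proof. by move=> f; apply: deck_eqP => x /=; rewrite deck_invK. Qed.

HB.instance Definition _ := isGroup.Build (deck p)
  deck_mulA deck_mul1g deck_mulg1 deck_mulVg deck_mulgV.

Definition galoisian := forall x x' : X, p x = p x' ->
  exists g : deck p, g x = x'.

End deck_group.

Definition normal_subgroup (G : groupType) (H : groupClosed G) :=
  forall g h : G, h \in H -> (h ^ g)%g \in H.

Definition quasi_galoisian (R : realType) (X Y : topologicalType)
    (p : X -> Y) :=
  exists2 Y1 : set Y, portly Y1 &
  exists (X1 : topologicalType) (p1 : X1 -> set_type Y1),
    [/\ covering R p1, connected [set: X1], galoisian p1 &
        is_completion R (set_val \o p1) p].

Section orbit_space.
Variables (X Y : topologicalType) (p : X -> Y) (H : groupClosed (deck p)).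
Local Notation Ord := (set_type (ordinary p)).

Definition orbit_rel (x x' : Ord) : bool :=
  `[< exists2 g : deck p, g \in H & g (set_val x) = set_val x' >].

Fact orbit_rel_refl : reflexive orbit_rel.
Proof. by move=> x; apply/asboolP; exists 1%g => //; exact: gpred1. Qed.

Fact orbit_rel_sym : symmetric orbit_rel.
Proof.
suff sub x x' : orbit_rel x x' -> orbit_rel x' x.
  by move=> x x'; apply/idP/idP; exact: sub.
move=> /asboolP[g gH gx]; apply/asboolP; exists (g^-1)%g.
  by rewrite gpredV.
by rewrite -gx; exact: deck_mapK.
Qed.

Fact orbit_rel_trans : transitive orbit_rel.
Proof.
move=> y x z /asboolP[g gH gx] /asboolP[h hH hy]; apply/asboolP.
by exists (h * g)%g; [rewrite gpredM|rewrite -hy -gx].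
Qed.

Definition orbit_equiv :=
  EquivRel orbit_rel orbit_rel_refl orbit_rel_sym orbit_rel_trans.

Definition orbit_space : Type := quotient_topology {eq_quot orbit_equiv}.

HB.instance Definition _ :=
  Topological.copy orbit_space (quotient_topology {eq_quot orbit_equiv}).
HB.instance Definition _ := Quotient.on orbit_space.

Definition orbit_proj (c : orbit_space) : Y := p (set_val (repr c)).

Lemma orbit_projE (x : Ord) : orbit_proj (\pi_orbit_space x) = p (set_val x).
Proof.
rewrite /orbit_proj; case: piP => y /eqmodP /asboolP[g _ <-].
by have /(congr1 (fun f : X -> Y => f (set_val x))) := deck_over g.
Qed.

End orbit_space.

(* X is isomorphic over Y to the completion of H\Ord(Xt) -> Y, for one (hence,
   by uniqueness of completions, for any) model X' of this completion. *)
Definition presented_by (R : realType) (Xt X Y : topologicalType)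
    (pt : Xt -> Y) (H : groupClosed (deck pt)) (p : X -> Y) :=
  exists (X' : topologicalType) (p' : X' -> Y),
    is_completion R (orbit_proj (H := H)) p' /\ isomorphic_over p p'.

(* Main.v *)
(* Let D be the complement of S.  Maps of the universal covering of D lift to
   every covering of D, and completeness of a spread extends a map from a portly
   subset to the whole space; so the completed universal covering Yt maps over Y
   to every complete spread X which is a covering over D, with any prescribed
   value at one point over D.  For X = Yt this makes the deck group transitive
   on the fibers over D.  Let H be the stabilizer of a map F : Yt -> X over Y.
   Two points of Ord(Yt) have the same image iff they are in the same H-orbit,
   so H\Ord(Yt) embeds in X as an open set containing the portly part over D.
   If H is normal then every deck map of Yt descends along F, so the part of X
   over D is a Galoisian covering.  Conversely, if X completes a Galoisian
   covering of a portly set Y1, then over Y1 and D the lifts F \o g and F differ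
   by a deck map of that covering, for every deck map g of Yt, whence F is
   invariant under the conjugates of H. *)
Require Import Defs.
From HB Require Import structures.
From mathcomp Require Import all_boot all_order all_algebra finmap.
From mathcomp Require Import all_classical all_reals topology normedtype.
From mathcomp Require Import homotopy.
Import Order.TTheory GRing.Theory Num.Theory numFieldNormedType.Exports.

Set Implicit Arguments.
Unset Strict Implicit.
Unset Printing Implicit Defensive.

Local Open Scope classical_set_scope.
Local Open Scope quotient_scope.
Local Open Scope ring_scope.

(** * Connectedness and paths *)

(** Neither [p] nor [pt] is a covering of all of [Y], so covering theory cannot be applied to them
    directly. Rigidity comes from one mechanism: when the ordinary locus is portly, the preimage of
    a portly set of ordinary points is portly again, hence connected when the total space is. Two
    maps over [Y] that agree at one point over such a set then agree over all of it by unique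
    lifting, and everywhere by density. The locus Ord(Yt) may be larger than the part over [D],
    while maps with a prescribed value exist only at points over [D]. Statements about orbits at the
    other ordinary points are reached by sliding along an evenly covered set to a point over [D] and
    back. The normality claim concerns every [H] that presents [X], not only the stabilizer built
    for existence. Therefore a map [F] is recovered from an arbitrary presentation, with the
    [H]-orbits as its fibers over [D]. *)

Lemma open_of_nbhs_sub (T : topologicalType) (A : set T) :
  (forall x, A x -> nbhs x A) -> open A.
Proof. by rewrite openE. Qed.

Lemma open_nbhs_sub (T : topologicalType) (x : T) (A : set T) :
  open A -> A x -> nbhs x A.
Proof. by move=> oA Ax; apply: open_nbhs_nbhs. Qed.

Section local_topology.
Variables T U : topologicalType.
Implicit Types (A B W : set T) (f g : T -> U).

Lemma openI_preimage A f (O : set U) : open A ->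
  (forall x, A x -> {for x, continuous f}) -> open O ->
  open (A `&` f @^-1` O).
Proof.
move=> oA fc oO; apply: open_of_nbhs_sub => x [Ax Ofx].
by apply: filterI; [exact: open_nbhs_sub|apply: fc => //; exact: open_nbhs_sub].
Qed.

Lemma image_connected A f : (forall x, A x -> {for x, continuous f}) ->
  connected A -> connected (f @` A).
Proof.
move=> fc cA; apply: connected_continuous_connected => //.
by apply: continuous_in_subspaceT => x /[!inE]; exact: fc.
Qed.

(** The two neighborhood conditions say pointwise that [B] is relatively open and relatively closed
    in [A]. Stating them with ambient neighborhoods and implications avoids the subspace topology
    and does not ask [A] to be open. *)
Lemma connected_clopen A B : connected A -> A `&` B !=set0 ->
  (forall x, A x -> B x -> nbhs x [set z | A z -> B z]) ->
  (forall x, A x -> ~ B x -> nbhs x [set z | A z -> ~ B z]) -> A `<=` B.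
Proof.
move=> cA AB0 Bo Bc.
have -> : A = A `&` B.
  apply/esym/cA => //.
    exists [set z | A z -> B z]^°; first exact: open_interior.
    apply/seteqP; split=> x [Ax]; first by move=> Bx; split=> //; exact: Bo.
    by move=> /interior_subset /(_ Ax).
  exists (~` [set z | A z -> ~ B z]^°); first exact/open_closedC/open_interior.
  apply/seteqP; split=> x [Ax Bx]; split=> //.
    by move=> /interior_subset /(_ Ax).
  by apply: contrapT => nBx; apply: Bx; exact: Bc.
by move=> x [].
Qed.

Lemma eq_on_dense W A f g : hausdorff_space U -> dense A -> open W ->
  (forall x, W x -> {for x, continuous f}) ->
  (forall x, W x -> {for x, continuous g}) ->
  (forall x, W x -> A x -> f x = g x) -> forall x, W x -> f x = g x.
Proof.
move=> hU dA oW fc gc fg x Wx; apply: hU => N N' fN gN.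
have : nbhs x (W `&` f @^-1` N `&` g @^-1` N').
  by apply: filterI; 
    [apply: filterI; [exact: open_nbhs_sub|exact: fc]|exact: gc].
rewrite nbhsE => -[O [oO Ox] OW].
have [z [Oz Az]] : O `&` A !=set0 by apply: dA => //; exists x.
have [[Wz Nz] N'z] := OW _ Oz.
by exists (f z); split=> //; rewrite fg.
Qed.

End local_topology.

Definition locally_connected (T : topologicalType) := forall (x : T) N,
  nbhs x N -> exists U, [/\ open U, U x, U `<=` N & connected U].

Section connectedness.
Variables (R : realType) (T : topologicalType).

Lemma connectedTR : connected [set: R].
Proof. exact/connected_intervalP. Qed.

Lemma component_open (A : set T) x : locally_connected T -> open A ->
  open (connected_component A x).
Proof.
move=> lcT oA; apply: open_of_nbhs_sub => y Cy.
have Ay := connected_component_sub Cy.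
have [U [oU Uy UA cU]] := lcT y A (open_nbhs_sub oA Ay).
rewrite nbhsE; exists U => //; rewrite (same_connected_component Cy).
exact: connected_component_max.
Qed.

(** Let [B] be a nonempty relatively clopen part of the trace. Each point of [W] has a neighborhood
    whose trace on [E] is connected, so lies inside [B] or misses it. Density of [E] makes the two
    cases exclusive, and both are open conditions, so connectedness of [W] leaves only the first. *)
Lemma connectedI_local (W E : set T) : dense E -> open W -> connected W ->
  (forall x, W x -> exists N, [/\ nbhs x N, N `<=` W & connected (N `&` E)]) ->
  connected (W `&` E).
Proof.
move=> dE oW cW locE B B0 [O oO BO] [C cC BC].
have BW x : B x -> W x by rewrite BO => -[[]].
have BE x : B x -> E x by rewrite BO => -[[]].
pose P := [set x : T | exists2 N, nbhs x N & N `&` E `<=` B].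
pose Q := [set x : T | exists2 N, nbhs x N & N `&` E `<=` ~` B].
have PQ x : W x -> P x \/ Q x.
  move=> Wx; have [N [Nx NW cN]] := locE x Wx.
  have [NB|NB] := pselect (N `&` E `&` B !=set0); last first.
    by right; exists N => // z NEz Bz; apply: NB; exists z.
  left; exists N => //.
  have -> : N `&` E = N `&` E `&` B.
    apply/esym/cN => //; [exists O => //|exists C => //]; apply/seteqP.
    - split=> z [[Nz Ez]]; last first.
      by move=> Oz; split=> //; rewrite BO; do ?split => //; exact: NW.
      by rewrite BO => -[_ Oz].
    - split=> z [[Nz Ez]]; last first.
      by move=> Oz; split=> //; rewrite BC; do ?split => //; exact: NW.
      by rewrite BC => -[_ Oz].
  by move=> z [].
have nPQ x : P x -> Q x -> False.
  move=> [N Nx NB] [N' N'x N'B].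
  have : nbhs x (N `&` N') by exact: filterI.
  rewrite nbhsE => -[V [oV Vx] VN].
  have [z [Vz Ez]] : V `&` E !=set0 by apply: dE => //; exists x.
  have [Nz N'z] := VN _ Vz.
  by apply: (N'B z) => //; exact: NB.
have nbP x : P x -> nbhs x P.
  move=> [N Nx NB]; move: Nx; rewrite nbhsE => -[V [oV Vx] VN].
  exists V => // z Vz; exists V; first exact: open_nbhs_sub.
  by move=> w [Vw Ew]; apply: NB; split=> //; exact: VN.
have nbQ x : Q x -> nbhs x Q.
  move=> [N Nx NB]; move: Nx; rewrite nbhsE => -[V [oV Vx] VN].
  exists V => // z Vz; exists V; first exact: open_nbhs_sub.
  by move=> w [Vw Ew]; apply: NB; split=> //; exact: VN.
have WP : W `<=` P.
  apply: connected_clopen => //.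
  - have [b Bb] := B0; exists b; split; first exact: BW.
    have [//|[N Nb NB]] := PQ b (BW _ Bb).
    by exfalso; apply: (NB b) => //; split; [exact: nbhs_singleton|exact: BE].
  - by move=> x _ Px; apply: filterS (nbP x Px) => z Pz _.
  - move=> x Wx nPx; have [//|Qx] := PQ x Wx.
    by apply: filterS (nbQ x Qx) => z Qz _ Pz; exact: nPQ Qz.
apply/seteqP; split=> [x Bx|x [Wx Ex]]; first by split; [exact: BW|exact: BE].
have [N Nx] := WP _ Wx; apply; split=> //; exact: nbhs_singleton.
Qed.

End connectedness.

Section unit_interval_paths.
Variable R : realType.
Local Notation J := (unit_interval R).

(** For [a <= b], a retraction of the line onto the interval. It turns paths and homotopies on
    intervals into maps on [R] and on the plane. *)
Definition clamp (a b t : R) : R := Num.max a (Num.min t b).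

Lemma clamp_continuous a b : continuous (clamp a b).
Proof.
have -> : clamp a b = cst a \max (id \min cst b) by [].
apply: max_fun_continuous; first exact: cst_continuous.
by apply: min_fun_continuous; [move=> t; exact: cvg_id|exact: cst_continuous].
Qed.

Lemma clamp_itv a b t : a <= b -> a <= clamp a b t <= b.
Proof. by move=> ab; rewrite /clamp le_max lexx ge_max ab ge_min lexx orbT. Qed.

Lemma clamp_id a b t : a <= t <= b -> clamp a b t = t.
Proof. by move=> /andP[a_t tb]; rewrite /clamp (min_idPl tb) (max_idPr a_t). Qed.

Fact clamp01_mem t : clamp 0 1 t \in (`[0, 1]%classic : set R).
Proof. by rewrite inE /= in_itv /= clamp_itv. Qed.

Definition clampJ (t : R) : J := exist _ (clamp 0 1 t) (clamp01_mem t).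

Lemma set_type_continuous (T U : topologicalType) (A : set U)
    (f : T -> set_type A) (x : T) :
  {for x, continuous (set_val \o f)} -> {for x, continuous f}.
Proof.
move=> fc N [_ [[O oO <-] Ofx ON]].
by apply: filterS ON _; apply: fc; exact: open_nbhs_sub.
Qed.

Lemma clampJ_continuous : continuous clampJ.
Proof. by move=> t; apply: set_type_continuous; exact: clamp_continuous. Qed.

Lemma valJ_continuous : continuous (set_val : J -> R).
Proof. exact: initial_continuous. Qed.

Lemma valJ_itv (t : J) : 0 <= set_val t <= 1.
Proof. by have := set_valP t; rewrite /= in_itv. Qed.

Lemma clampJK : cancel (set_val : J -> R) clampJ.
Proof. by move=> t; apply: val_inj; rewrite /= clamp_id// valJ_itv. Qed.

Lemma connected_path (T : topologicalType) (g : J -> T) :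
  continuous g -> connected (range g).
Proof.
move=> gc; have -> : range g = range (g \o clampJ).
  apply/seteqP; split=> _ [t _ <-]; last by exists (clampJ t).
  by exists (set_val t) => //=; rewrite clampJK.
apply: image_connected; last exact: connectedTR.
by move=> t _; apply: (@continuous_comp _ _ _ clampJ g);
  [exact: clampJ_continuous|exact: gc].
Qed.

Variable T : topologicalType.

Lemma path_connected_connected (A : set T) : path_connected R A -> connected A.
Proof.
move=> pA; have [[x Ax]|A0] := pselect (A !=set0); last first.
  by move=> B [x Bx] [O _ BO]; exfalso; apply: A0; exists x;
    move: Bx; rewrite BO => -[].
have <- : connected_component A x = A; last exact: component_connected.
apply/seteqP; split; first exact: connected_component_sub.
move=> y Ay; have [g gA] := pA x y Ax Ay.
exists (range g); last by exists one => //; exact: path_one.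
by split=> //; [exists zero => //; exact: path_zero|];
  apply: connected_path; exact: cts_fun.
Qed.

Lemma lpc_basis (x : T) N : locally_path_connected R T -> nbhs x N ->
  exists U : set T, [/\ open U, U x, U `<=` N & path_connected R U].
Proof.
by move=> [_ /(_ x)] /[apply] -[U [[oU pU] Ux] UN]; exists U.
Qed.

Lemma lpc_locally_connected :
  locally_path_connected R T -> locally_connected T.
Proof.
move=> lpc x N /(lpc_basis lpc) [U [oU Ux UN pU]]; exists U; split=> //.
exact: path_connected_connected.
Qed.

Lemma admissible_locally_connected :
  admissible_space R T -> locally_connected T.
Proof. by case=> _ /lpc_locally_connected. Qed.

End unit_interval_paths.

(** * Evenly covered sets and unique lifting *)

Section separation.
Variables T U : topologicalType.

Lemma near_neq (f g : T -> U) x : hausdorff_space U ->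
  {for x, continuous f} -> {for x, continuous g} -> f x <> g x ->
  nbhs x [set z | f z <> g z].
Proof.
rewrite open_hausdorff => hU fc gc /eqP /hU [[A B] /= [/[!inE] Af Bg]].
move=> [oA oB AB0].
have : nbhs x (f @^-1` A `&` g @^-1` B).
  by apply: filterI; [apply: fc|apply: gc]; exact: open_nbhs_sub.
apply: filterS => z [Az Bz] fg.
have : (A `&` B) (f z) by split; [|rewrite fg].
by rewrite AB0.
Qed.

End separation.

Section sheets.
Variables (X Y : topologicalType) (p : X -> Y).

(** The function is total, with arbitrary values off [U]. Continuity is asked in the topology of
    [Y], which for open [U] is the same as continuity on the subspace. *)
Definition section_on (U : set Y) (s : Y -> X) :=
  (forall u, U u -> p (s u) = u) /\ (forall u, U u -> {for u, continuous s}).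

(* [U] is evenly covered: the component of a point is the image of a section. *)
Definition sheets (U : set Y) := [/\ open U, connected U &
  forall x, U (p x) -> exists s, [/\ section_on U s, s (p x) = x &
    connected_component (p @^-1` U) x = s @` U]].

Hypotheses (hX : hausdorff_space X) (lX : locally_connected X).
Hypotheses (lY : locally_connected Y) (cp : continuous p).

Lemma open_preimage (U : set Y) : open U -> open (p @^-1` U).
Proof. by move: cp => /continuousP; exact. Qed.

(** An evenly covered set [U0] may be shrunk to a connected [U]: a component over [U] lies in a
    component over [U0], on which [p] has a continuous inverse, and the image of [U] under this
    inverse is connected, hence the whole component. *)
Lemma ordinary_sheets y N : ordinary_base p y -> nbhs y N ->
  exists U, [/\ U y, U `<=` N & sheets U].
Proof.
move=> [U0 [oU0 U0y] hU0] Ny.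
have [U [oU Uy UN cU]] : exists U, [/\ open U, U y, U `<=` U0 `&` N & connected U].
  by apply: lY; apply: filterI => //; exact: open_nbhs_sub.
exists U; split=> //; first by move=> u /UN[].
split=> // x Ux.
have UU0 u : U u -> U0 u by move=> /UN[].
pose C := connected_component (p @^-1` U0) x.
have Cx : C x by apply: connected_component_refl; exact: UU0.
have [[Cfun Cinj Csurj] _ Copen] : homeomorphism_on C U0 p.
  by apply: hU0; exists x => //; exact: UU0.
have /choice [s sP] : forall u, exists c, U0 u -> C c /\ p c = u.
  move=> u; have [U0u|nU0u] := pselect (U0 u); last by exists x.
  by have [c Cc <-] := Csurj u U0u; exists c.
have sK c : C c -> s (p c) = c.
  move=> Cc; have [Cs ps] := sP _ (Cfun _ Cc).
  by apply: Cinj; rewrite ?inE.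
have sx : s (p x) = x by exact: sK.
have secs : section_on U s.
  split=> [u /UU0 /sP[]//|u Uu N' N's].
  move: N's; rewrite nbhsE => -[O [oO Os] ON'].
  have [V oV pV] := Copen O oO.
  have [Csu psu] := sP _ (UU0 _ Uu).
  have : nbhs u (U0 `&` V).
    apply: open_nbhs_sub; first exact: openI.
    by rewrite -pV; exists (s u).
  apply: filterS => v; rewrite -pV => -[c [Cc Oc] <-].
  by apply: ON'; rewrite sK.
exists s; split=> //; apply/seteqP; split=> [z zC|_ [u Uu <-]].
  have Cz : C z.
    apply: (connected_component_max _ _ (@component_connected _ (p @^-1` U) x)) => //.
      exact: connected_component_refl.
    by move=> w /connected_component_sub /UU0.
  by exists (p z); [exact: (connected_component_sub zC)|exact: sK].
have sUx : (s @` U) x by exists (p x).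
apply: (connected_component_max sUx); last by exists u.
- by move=> _ [v Uv <-] /=; rewrite secs.1.
- by apply: image_connected => //; exact: secs.2.
Qed.

Lemma sheets_homeo U C : sheets U -> is_component (p @^-1` U) C ->
  homeomorphism_on C U p.
Proof.
move=> [oU cU sU] [x Ux ->]; have [s [[ps sc] sx ->]] := sU x Ux.
split.
- split.
  + by move=> _ [u Uu <-]; rewrite /= ps.
  + by move=> _ _ /[!inE] -[u Uu <-] [v Uv <-]; rewrite !ps// => ->.
  + by move=> u Uu; exists (s u); [exists u|exact: ps].
- exact: continuous_subspaceT.
- move=> O oO; exists (U `&` s @^-1` O); first exact: openI_preimage.
  apply/seteqP; split=> [_ [_ [[u Uu <-] Osu] <-]|u [Uu [_ Osu]]].
    by rewrite ps//.
  by exists (s u); [split=> //; exists u|exact: ps].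
Qed.

Lemma sheets_ordinary U y : sheets U -> U y -> ordinary_base p y.
Proof.
move=> sU Uy; exists U; first by split=> //; case: sU.
by move=> C; exact: sheets_homeo.
Qed.

Lemma sheet_open U s x : sheets U -> U (p x) ->
  connected_component (p @^-1` U) x = s @` U -> open (s @` U).
Proof.
by move=> [oU _ _] _ <-; apply: component_open => //; exact: open_preimage.
Qed.

(** The coincidence set is open because near a common value both lifts stay on one sheet, where [p]
    is injective; it is closed because [X] is Hausdorff. *)
Lemma lift_unique (T : topologicalType) (A : set T) (f g : T -> X) t0 :
  connected A -> (forall t, A t -> {for t, continuous f}) ->
  (forall t, A t -> {for t, continuous g}) ->
  (forall t, A t -> p (f t) = p (g t)) ->
  (forall t, A t -> ordinary_base p (p (f t))) ->
  A t0 -> f t0 = g t0 -> forall t, A t -> f t = g t.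
Proof.
move=> cA fc gc pfg pO At0 fg0.
apply: (@connected_clopen _ A [set t | f t = g t]) => //.
- by exists t0.
- move=> t At /= fgt; have [U [Uy _ sU]] := ordinary_sheets (pO t At) filterT.
  have [oU _ /(_ _ Uy) [s [[ps sc] sx sC]]] := sU.
  have oC := sheet_open sU Uy sC.
  have sft : (s @` U) (f t) by exists (p (f t)).
  have : nbhs t (f @^-1` (s @` U) `&` g @^-1` (s @` U)).
    apply: filterI; first by apply: fc => //; exact: open_nbhs_sub.
    by apply: gc => //; apply: open_nbhs_sub; rewrite -?fgt.
  apply: filterS => z [/= [u Uu su] [v Uv sv]] /pfg.
  by rewrite -su -sv !ps// => ->.
- move=> t At nfg; apply: filterS (near_neq hX (fc _ At) (gc _ At) nfg) => z.
  by move=> nfgz _.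
Qed.

End sheets.

(** * Lifting squares *)

Section real_line.
Variable R : realType.

Lemma glue_continuous (T U : topologicalType) (u : T -> R) (f g : T -> U) m :
  continuous u -> continuous f -> continuous g ->
  (forall t, u t = m -> f t = g t) ->
  continuous (fun t => if u t <= m then f t else g t).
Proof.
move=> uc fc gc fg t N; case: (ltgtP (u t) m) => [ltm|gtm|eqm] Nt.
- have : nbhs t (f @^-1` N `&` u @^-1` [set x | x < m]).
    apply: filterI; first exact: fc.
    by apply: uc; apply: open_nbhs_sub; first exact: open_lt.
  by apply: filterS => z [Nz /= /ltW zm]; rewrite /= zm.
- have : nbhs t (g @^-1` N `&` u @^-1` [set x | m < x]).
    apply: filterI; first exact: gc.
    by apply: uc; apply: open_nbhs_sub; first exact: open_gt.
  by apply: filterS => z [Nz /= zm]; rewrite /= leNgt zm.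
- have : nbhs t (f @^-1` N `&` g @^-1` N).
    by apply: filterI; [exact: fc|apply: gc; rewrite -fg].
  by apply: filterS => z [Nfz Ngz] /=; case: ifP.
Qed.

(** Compactness of a segment in the form of an induction principle; it replaces subdivision by a
    Lebesgue number. The supremum of the endpoints reachable from [a] is shown to be passed unless
    it is [b]. *)
Lemma interval_ind (P : R -> R -> Prop) :
  (forall a m b, a <= m -> m <= b -> P a m -> P m b -> P a b) ->
  (forall x, exists2 d, 0 < d &
     forall a b, x - d < a -> a <= b -> b < x + d -> P a b) ->
  forall a b, a <= b -> P a b.
Proof.
move=> glue loc a b ab.
have Pxx x : P x x.
  have [d d0 Pd] := loc x; apply: Pd => //; first by rewrite ltrBlDr ltrDl.
  by rewrite ltrDl.
pose A := [set t | a <= t <= b /\ P a t].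
have Aa : A a by split; rewrite ?lexx.
have ubA : ubound A b by move=> t [/andP[]].
have supA : has_sup A by split; [exists a|exists b].
have [d d0 Pd] := loc (sup A).
have [t [/andP[a_t tb] Pat] st] := sup_adherent d0 supA.
have ts : t <= sup A by apply: sup_upper_bound => //; split; rewrite ?a_t.
have sb : sup A <= b by apply: ge_sup; [exists a|].
(* Half of [d] keeps the new endpoint strictly inside the local radius around the supremum while
   still going beyond it; so membership of [s'] in [A] is possible only if the minimum is [b]. *)
pose s' := Num.min b (sup A + d / 2).
have ss' : sup A <= s' by rewrite le_min sb lerDl divr_ge0// ltW.
have s'd : s' < sup A + d.
  by rewrite gt_min ltrD2l ltr_pdivrMr// ltr_pMr// ltr1n orbT.
have Pas' : P a s'.
  apply: (glue a t s') => //; first exact: le_trans ts ss'.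
  by apply: Pd => //; exact: le_trans ts ss'.
have : s' <= sup A.
  apply: sup_upper_bound => //; split=> //.
  by rewrite (le_trans a_t (le_trans ts ss'))/= ge_min lexx.
rewrite ge_min => /orP[bs|]; last first.
  by rewrite gerDl leNgt divr_gt0.
suff -> : b = s' by [].
by apply/esym/min_idPl; rewrite (le_trans bs)// lerDl divr_ge0// ltW.
Qed.

Lemma clampl (a m b t : R) : a <= m -> m <= b -> t <= m -> clamp a b t = clamp a m t.
Proof. by move=> am mb tm; rewrite /clamp !min_l// (le_trans tm). Qed.

Lemma clampr (a m b t : R) : a <= m -> m <= b -> m <= t -> clamp a b t = clamp m b t.
Proof.
move=> am mb tm; have mt : m <= Num.min t b by rewrite le_min tm.
by rewrite /clamp !max_r// (le_trans am).
Qed.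

Lemma clamp_lb (a b : R) : a <= b -> clamp a b a = a.
Proof. by move=> ab; rewrite clamp_id// lexx. Qed.

Lemma clamp_ub (a b : R) : a <= b -> clamp a b b = b.
Proof. by move=> ab; rewrite clamp_id// lexx andbT. Qed.

Lemma pair_continuous (T U V : topologicalType) (f : T -> U) (g : T -> V) x :
  {for x, continuous f} -> {for x, continuous g} ->
  {for x, continuous (fun t => (f t, g t))}.
Proof.
move=> fc gc N [[A B] /= [fA gB] AB].
have : nbhs x (f @^-1` A `&` g @^-1` B).
  by apply: filterI; [exact: fc|exact: gc].
by apply: filterS => z [Az Bz]; exact: AB.
Qed.

Lemma clamp2_continuous (a b c d : R) :
  continuous (fun st : R * R => (clamp a b st.1, clamp c d st.2)).
Proof.
move=> st; apply: (@pair_continuous _ R R (clamp a b \o fst) (clamp c d \o snd)).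
  apply: (@continuous_comp _ _ _ fst (clamp a b)); first exact: cvg_fst.
  exact: clamp_continuous.
apply: (@continuous_comp _ _ _ snd (clamp c d)); first exact: cvg_snd.
exact: clamp_continuous.
Qed.

End real_line.

Section square_lifting.
Variables (R : realType) (X Y : topologicalType) (p : X -> Y).
Hypotheses (hX : hausdorff_space X) (lX : locally_connected X).
Hypotheses (lY : locally_connected Y) (cp : continuous p).
Variable h : R * R -> Y.
Hypotheses (hc : continuous h) (hO : forall st, ordinary_base p (h st)).

(* [H] is total: a lift over the rectangle is extended by clamping, so that only
   globally continuous maps have to be glued. *)
Definition rect_lift (a b c d : R) := forall e, p e = h (a, c) ->
  exists H : R * R -> X, [/\ continuous H,
    forall st, p (H st) = h (clamp a b st.1, clamp c d st.2) & H (a, c) = e].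

Lemma pairl_continuous (s : R) : continuous (fun t : R => (s, t)).
Proof.
move=> t; apply: (@pair_continuous _ R R (cst s) id); last exact: cvg_id.
exact: cvg_cst.
Qed.

Lemma pairr_continuous (t : R) : continuous (fun s : R => (s, t)).
Proof.
move=> s; apply: (@pair_continuous _ R R id (cst t)); first exact: cvg_id.
exact: cvg_cst.
Qed.

Lemma lift_uniqueR (f g : R -> X) t0 : continuous f -> continuous g ->
  (forall t, p (f t) = p (g t)) -> (forall t, ordinary_base p (p (f t))) ->
  f t0 = g t0 -> f =1 g.
Proof.
move=> fc gc pfg fO fg t.
apply: (lift_unique hX lX lY cp (@connectedTR R) _ _ _ _ _ fg) => // s _.
- exact: fc.
- exact: gc.
Qed.

(** The second lift is started at the value of the first one at the corner [(m, c)]. Along the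
    common edge both lift the same path, so they agree there by unique lifting and can be pasted. *)
Lemma rect_lift_gluel a m b c d : a <= m -> m <= b -> c <= d ->
  rect_lift a m c d -> rect_lift m b c d -> rect_lift a b c d.
Proof.
move=> am mb cd L1 L2 e pe.
have [H1 [H1c pH1 H1e]] := L1 e pe.
have [|H2 [H2c pH2 H2e]] := L2 (H1 (m, c)).
  by rewrite pH1 /= clamp_ub// clamp_lb.
have H12 t : H1 (m, t) = H2 (m, t).
  apply: (@lift_uniqueR (fun t => H1 (m, t)) (fun t => H2 (m, t)) c) => //.
  - by move=> s; apply: (@continuous_comp _ _ _ (pair m) H1);
      [exact: pairl_continuous|exact: H1c].
  - by move=> s; apply: (@continuous_comp _ _ _ (pair m) H2);
      [exact: pairl_continuous|exact: H2c].
  - by move=> s; rewrite pH1 pH2 /= clamp_ub// clamp_lb.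
  - by move=> s; rewrite pH1.
exists (fun st => if st.1 <= m then H1 st else H2 st); split.
- apply: glue_continuous => // [st|[s t] /= ->]; last exact: H12.
  exact: cvg_fst.
- move=> [s t] /=; case: leP => sm; first by rewrite pH1 /= (@clampl _ a m b).
  by rewrite pH2 /= (@clampr _ a m b)// ltW.
- by rewrite /= am.
Qed.

Lemma rect_lift_gluer a b c m d : a <= b -> c <= m -> m <= d ->
  rect_lift a b c m -> rect_lift a b m d -> rect_lift a b c d.
Proof.
move=> ab cm md L1 L2 e pe.
have [H1 [H1c pH1 H1e]] := L1 e pe.
have [|H2 [H2c pH2 H2e]] := L2 (H1 (a, m)).
  by rewrite pH1 /= clamp_ub// clamp_lb.
have H12 t : H1 (t, m) = H2 (t, m).
  apply: (@lift_uniqueR (fun t => H1 (t, m)) (fun t => H2 (t, m)) a) => //.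
  - by move=> s; apply: (@continuous_comp _ _ _ (fun s => (s, m)) H1);
      [exact: pairr_continuous|exact: H1c].
  - by move=> s; apply: (@continuous_comp _ _ _ (fun s => (s, m)) H2);
      [exact: pairr_continuous|exact: H2c].
  - by move=> s; rewrite pH1 pH2 /= clamp_ub// clamp_lb.
  - by move=> s; rewrite pH1.
exists (fun st => if st.2 <= m then H1 st else H2 st); split.
- apply: glue_continuous => // [st|[s t] /= ->]; last exact: H12.
  exact: cvg_snd.
- move=> [s t] /=; case: leP => sm; first by rewrite pH1 /= (@clampl _ c m d).
  by rewrite pH2 /= (@clampr _ c m d)// ltW.
- by rewrite /= cm.
Qed.

Lemma rect_lift_local x y : exists2 r, 0 < r & forall a b c d,
  x - r < a -> a <= b -> b < x + r -> y - r < c -> c <= d -> d < y + r ->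
  rect_lift a b c d.
Proof.
have [U [Uh _ sU]] := ordinary_sheets lY (hO (x, y)) filterT.
have [oU _ sec] := sU.
have [[A B] /= [Ax By] AB] : nbhs (x, y) (h @^-1` U).
  by apply: hc; exact: open_nbhs_sub.
move: Ax By => /nbhs_ballP[r1 /= r10 r1A] /nbhs_ballP[r2 /= r20 r2B].
pose r := Num.min r1 r2.
have r0 : 0 < r by rewrite lt_min r10.
exists r => // a b c d xa ab bx yc cd dy e pe.
have Uab s t : a <= s <= b -> c <= t <= d -> U (h (s, t)).
  move=> /andP[a_s sb] /andP[ct td]; apply: AB; split=> /=.
    apply: r1A; rewrite /ball /= ltr_distlC.
    apply/andP; split.
      by rewrite (lt_le_trans _ a_s)// (le_lt_trans _ xa)// lerD2l lerN2 ge_min lexx.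
    by rewrite (le_lt_trans sb)// (lt_le_trans bx)// lerD2l ge_min lexx.
  apply: r2B; rewrite /ball /= ltr_distlC.
  apply/andP; split.
    by rewrite (lt_le_trans _ ct)// (le_lt_trans _ yc)// lerD2l lerN2 ge_min lexx orbT.
  by rewrite (le_lt_trans td)// (lt_le_trans dy)// lerD2l ge_min lexx orbT.
have [|s [[ps sc] se _]] := sec e.
  by rewrite pe; apply: Uab; rewrite lexx.
pose k (st : R * R) := (clamp a b st.1, clamp c d st.2).
have Uk st : U (h (k st)) by apply: Uab; exact: clamp_itv.
exists (s \o (h \o k)); split.
- move=> st; apply: continuous_comp; last exact/sc/Uk.
  by apply: (@continuous_comp _ _ _ k h); [exact: clamp2_continuous|exact: hc].
- by move=> st /=; rewrite ps.
- by rewrite /= /k /= !clamp_lb// -pe.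
Qed.

Lemma square_lift a b c d : a <= b -> c <= d -> rect_lift a b c d.
Proof.
move=> ab; apply: interval_ind => [c' m d' cm md|y].
  exact: rect_lift_gluer.
(* The outer induction stretches the rectangle vertically, the inner one horizontally at a fixed
   height [y]. The height [r] is part of the inner property, so that pasting two pieces can take the
   smaller of their heights. *)
pose P a b := exists2 r, 0 < r & forall c d,
  y - r < c -> c <= d -> d < y + r -> rect_lift a b c d.
apply: (@interval_ind _ P) ab => [a' m b' am mb [r r0 Lr] [r' r'0 Lr']|x].
  exists (Num.min r r'); first by rewrite lt_min r0.
  move=> c' d' yc cd dy; apply: (@rect_lift_gluel a' m b') => //.
    apply: Lr => //; last by rewrite (lt_le_trans dy)// lerD2l ge_min lexx.
    by rewrite (le_lt_trans _ yc)// lerD2l lerN2 ge_min lexx.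
  apply: Lr' => //; last by rewrite (lt_le_trans dy)// lerD2l ge_min lexx orbT.
  by rewrite (le_lt_trans _ yc)// lerD2l lerN2 ge_min lexx orbT.
have [r r0 Lr] := rect_lift_local x y.
by exists r => // a' b' xa ab bx; exists r => // *; exact: Lr.
Qed.

End square_lifting.

(** * Lifting from simply connected spaces *)

Section linked_points.
Variables (R : realType) (T : topologicalType) (A : set T).

(** Being joined by a path in [A], with the path parametrized by the whole line so that it can be
    fed to the lifting lemmas. *)
Definition linked (x y : T) := exists w : R -> T,
  [/\ continuous w, forall t, A (w t), w 0 = x & w 1 = y].

Lemma linked_sym x y : linked x y -> linked y x.
Proof.
move=> [w [wc wA w0 w1]]; exists (w \o (fun t => 1 - t)); split.
- move=> t; apply: (@continuous_comp _ _ _ (fun t : R => 1 - t) w); last exact: wc.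
  by apply: (@continuousB R R^o _ (cst 1) id); [exact: cvg_cst|exact: cvg_id].
- by move=> t; exact: wA.
- by rewrite /= subr0.
- by rewrite /= subrr.
Qed.

Lemma linked_trans y x z : linked x y -> linked y z -> linked x z.
Proof.
move=> [v [vc vA v0 v1]] [w [wc wA w0 w1]].
pose f t := v (clamp 0 1 (t *+ 2)); pose g t := w (clamp 0 1 (t *+ 2 - 1)).
have dc : continuous (fun t : R => t *+ 2).
  by move=> t; apply: (@continuousD R R^o _ id id); exact: cvg_id.
have fc : continuous f.
  move=> t; apply: (@continuous_comp _ _ _ (clamp 0 1 \o (fun t => t *+ 2)) v);
    last exact: vc.
  by apply: (@continuous_comp _ _ _ (fun t : R => t *+ 2) (clamp 0 1));
    [exact: dc|exact: clamp_continuous].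
have gc : continuous g.
  move=> t.
  apply: (@continuous_comp _ _ _ (clamp 0 1 \o (fun t => t *+ 2 - 1)) w);
    last exact: wc.
  apply: (@continuous_comp _ _ _ (fun t : R => t *+ 2 - 1) (clamp 0 1));
    last exact: clamp_continuous.
  by apply: (@continuousB R R^o _ (fun t : R => t *+ 2) (cst 1));
    [exact: dc|exact: cvg_cst].
have h2 : (2^-1 : R) *+ 2 = 1 by rewrite -[LHS]mulr_natr mulVf// pnatr_eq0.
exists (fun t => if t <= 2^-1 then f t else g t); split.
- apply: (@glue_continuous _ _ _ id) => //; first by move=> t; exact: cvg_id.
  by move=> _ ->; rewrite /f /g h2 subrr clamp_ub// clamp_lb// v1 w0.
- by move=> t; case: ifP => _; [exact: vA|exact: wA].
- by rewrite invr_ge0 ler0n /f mul0rn clamp_lb.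
- by rewrite leNgt invf_lt1 ?ltr0n// ltr1n /= /g mulr2n addrK clamp_ub.
Qed.

End linked_points.

Section lifting.
Variables (R : realType) (X Y T : topologicalType) (p : X -> Y) (k : T -> Y).
Hypotheses (hX : hausdorff_space X) (lX : locally_connected X).
Hypotheses (lY : locally_connected Y) (cp : continuous p).
Hypotheses (scT : simply_connected R T) (lT : locally_path_connected R T).
Hypotheses (kc : continuous k) (kO : forall z, ordinary_base p (k z)).
Local Notation J := (unit_interval R).

Lemma clampJ0 : clampJ 0 = zero :> J.
Proof. by apply: val_inj; rewrite /= clamp_lb. Qed.

Lemma clampJ1 : clampJ 1 = one :> J.
Proof. by apply: val_inj; rewrite /= clamp_ub. Qed.

Lemma clampJ_clamp (t : R) : clampJ (clamp 0 1 t) = clampJ t.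
Proof. by apply: val_inj; rewrite /= clamp_id// clamp_itv. Qed.

(* The lift of a null-homotopy of the loop is constant on three sides of the
   square. *)
Lemma loop_lift (g : R -> T) (b : R -> X) : continuous g -> continuous b ->
  g 0 = g 1 -> (forall t, p (b t) = k (g t)) -> b 0 = b 1.
Proof.
move=> gc bc g01 pb.
pose gJ : J -> T := g \o set_val.
have gJc : continuous gJ.
  move=> t; apply: (@continuous_comp _ _ _ (set_val : J -> R) g); last exact: gc.
  exact: valJ_continuous.
have gJ0 : gJ zero = g 0 by [].
have gJ1 : gJ one = g 0 by rewrite g01.
have [_ /(_ (g 0) (mk_path gJc gJ0 gJ1))] := scT.
move=> [h hc [h0 h1 h2 h3]].
pose kh (st : R * R) := k (h (clampJ st.1, clampJ st.2)).
have khc : continuous kh.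
  move=> st.
  apply: (@continuous_comp _ _ _ (fun st => (clampJ st.1, clampJ st.2)) (k \o h)).
    apply: (@pair_continuous (R * R)%type J J (@clampJ R \o fst) (@clampJ R \o snd)).
      apply: (@continuous_comp _ _ _ fst (@clampJ R)); first exact: cvg_fst.
      exact: clampJ_continuous.
    apply: (@continuous_comp _ _ _ snd (@clampJ R)); first exact: cvg_snd.
    exact: clampJ_continuous.
  by apply: (@continuous_comp _ _ _ h k); [exact: hc|exact: kc].
have khO st : ordinary_base p (kh st) by exact: kO.
have pb0 : p (b 0) = kh (0, 0) by rewrite /kh /= clampJ0 h0 pb.
have [H [Hc pH H00]] := square_lift hX lX lY cp khc khO ler01 ler01 pb0.
have Hl s : continuous (fun t => H (s, t)).
  move=> t; apply: (@continuous_comp _ _ _ (pair s) H); last exact: Hc.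
  exact: pairl_continuous.
have Hr t : continuous (fun s => H (s, t)).
  move=> s; apply: (@continuous_comp _ _ _ (fun s => (s, t)) H); last exact: Hc.
  exact: pairr_continuous.
have pHO st : ordinary_base p (p (H st)) by rewrite pH.
have constant (f : R -> X) t0 : continuous f -> (forall t, p (f t) = k (g 0)) ->
    f t0 = b 0 -> forall t, f t = b 0.
  move=> fc pf ft0; apply: (lift_uniqueR hX lX lY cp fc _ _ _ ft0).
  - exact: cst_continuous.
  - by move=> t; rewrite pf pb.
  - by move=> t; rewrite pf.
have left_side : forall s, H (0, s) = b 0.
  apply: (constant _ 0 (Hl 0)) => // s.
  by rewrite pH /kh /= clamp_lb// clampJ0 h2.
have top_side : forall s, H (s, 1) = b 0.
  apply: (constant _ 0 (Hr 1)) => // s.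
  by rewrite pH /kh /= clamp_ub// clampJ1 h1.
have right_side : forall s, H (1, s) = b 0.
  apply: (constant _ 1 (Hl 1)) => // s.
  by rewrite pH /kh /= clamp_ub// clampJ1 h3.
rewrite -(right_side 0).
have -> : b 1 = b (clamp 0 1 1) by rewrite clamp_ub.
apply: (@lift_uniqueR _ _ _ _ hX lX lY cp (fun s => H (s, 0)) (b \o clamp 0 1) 0) => //.
- move=> t; apply: (@continuous_comp _ _ _ (clamp 0 1) b); last exact: bc.
  exact: clamp_continuous.
- by move=> t; rewrite pH /kh /= clamp_lb// clampJ0 h0 clampJ_clamp /= pb.
- by rewrite H00 /= clamp_lb.
Qed.

Let fibered : set (T * X) := [set zx | p zx.2 = k zx.1].

(** The graph of the lift is the path component of [(z0, x0)] in the fiber product [fibered]. By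
    [loop_lift] it contains at most one point above each [z], and lifting a path from [z0] to [z]
    provides one. *)
Lemma lift_simply_connected z0 x0 : k z0 = p x0 ->
  exists f : T -> X, [/\ continuous f, forall z, p (f z) = k z & f z0 = x0].
Proof.
move=> kz0.
pose joined := linked R fibered.
have joined_fun z x x' : joined (z, x) (z, x') -> x = x'.
  move=> [w [wc wA w0 w1]].
  have /= := @loop_lift (fst \o w) (snd \o w); rewrite w0 w1; apply => //.
  - by move=> t; apply: (@continuous_comp _ _ _ w fst); [exact: wc|exact: cvg_fst].
  - by move=> t; apply: (@continuous_comp _ _ _ w snd); [exact: wc|exact: cvg_snd].
have joined_total z : exists x, joined (z0, x0) (z, x).
  have [/(_ z0 z I I) [g _] _] := scT.
  (* A path is lifted as a square that is constant in its second variable. *)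
  pose h (st : R * R) := k (g (clampJ st.1)).
  have gcc : continuous (g \o @clampJ R).
    move=> t; apply: (@continuous_comp _ _ _ (@clampJ R) g).
      exact: clampJ_continuous.
    exact: cts_fun.
  have hc : continuous h.
    move=> st; apply: (@continuous_comp _ _ _ (g \o @clampJ R \o fst) k).
      apply: (@continuous_comp _ _ _ fst (g \o @clampJ R)); first exact: cvg_fst.
      exact: gcc.
    exact: kc.
  have hO st : ordinary_base p (h st) by exact: kO.
  have ph0 : p x0 = h (0, 0) by rewrite /h /= clampJ0 path_zero.
  have [H [Hc pH H00]] := square_lift hX lX lY cp hc hO ler01 ler01 ph0.
  exists (H (1, 0)), (fun s => (g (clampJ s), H (s, 0))); split.
  - move=> s; apply: (@pair_continuous R T X (g \o @clampJ R) (fun s => H (s, 0))).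
      exact: gcc.
    apply: (@continuous_comp _ _ _ (fun s => (s, 0)) H); last exact: Hc.
    exact: pairr_continuous.
  - by move=> s; rewrite /fibered /= pH /h /= clampJ_clamp.
  - by rewrite clampJ0 path_zero H00.
  - by rewrite clampJ1 path_one.
have /choice [f fP] := joined_total.
have f_eq z x : joined (z0, x0) (z, x) -> f z = x.
  by move=> zx; apply: (joined_fun z); exact: linked_trans (linked_sym (fP z)) zx.
have pf z : p (f z) = k z.
  by have [w [_ wA _ w1]] := fP z; have := wA 1; rewrite w1.
exists f; split=> //; last first.
  by apply: f_eq; exists (cst (z0, x0)); split=> // t; exact: cvg_cst.
move=> z N Nfz.
have [U [Ukz _ [oU cU sU]]] := ordinary_sheets lY (kO z) filterT.
have [|s [[ps sc] sx _]] := sU (f z); first by rewrite pf.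
have Uk : nbhs z (k @^-1` U) by apply: kc; exact: open_nbhs_sub.
have [V [oV Vz VU pV]] := lpc_basis lT Uk.
have skc z' : V z' -> {for z', continuous (s \o k)}.
  by move=> /VU Uz'; apply: continuous_comp; [exact: kc|exact: sc].
(* A path in [V] from [z] to [z'], followed upstairs along the section [s], prolongs the path that
   defines [f z]; so near [z] the lift is a continuous section composed with [k]. *)
have fs z' : V z' -> f z' = s (k z').
  move=> Vz'; apply: f_eq; apply: (linked_trans (fP z)).
  have [g gV] := pV z z' Vz Vz'.
  have Vg t : V (g t) by apply: gV; exists t.
  exists (fun t => (g (clampJ t), s (k (g (clampJ t))))); split.
  - have gcc t : {for t, continuous (g \o @clampJ R)}.
      apply: (@continuous_comp _ _ _ (@clampJ R) g).
        exact: clampJ_continuous.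
      exact: cts_fun.
    move=> t; apply: (@pair_continuous R T X (g \o @clampJ R)
      (s \o k \o (g \o @clampJ R))); first exact: gcc.
    apply: (@continuous_comp _ _ _ (g \o @clampJ R) (s \o k)); first exact: gcc.
    by apply: skc; exact: Vg.
  - by move=> t; rewrite /fibered /= ps//; exact: VU.
  - by rewrite clampJ0 path_zero -pf sx.
  - by rewrite clampJ1 path_one.
have : nbhs z (V `&` (s \o k) @^-1` N).
  by apply: filterI; [exact: open_nbhs_sub|apply: skc => //=; rewrite -fs].
by apply: filterS => z' [Vz' Nz'] /=; rewrite fs.
Qed.

End lifting.

(** * Embeddings, portly sets and spreads *)

Section embeddings.
Variables (T U : topologicalType) (e : T -> U).

Lemma embedding_inj : embedding e -> injective e.
Proof. by move=> [[_ einj _] _ _] x y; apply: einj; rewrite inE. Qed.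

Lemma embedding_continuous : embedding e -> continuous e.
Proof. by move=> [_ ec _]; exact/continuous_subspace_setT. Qed.

Lemma embedding_image_open (O : set T) : embedding e -> open (range e) ->
  open O -> open (e @` O).
Proof.
move=> [_ _ eo] oe /eo[V oV]; rewrite setTI => ->; exact: openI.
Qed.

Lemma open_embedding : injective e -> continuous e ->
  (forall O, open O -> open (e @` O)) -> embedding e.
Proof.
move=> einj ec eo; split.
- by split=> // x y _ _; exact: einj.
- exact: continuous_subspaceT.
- move=> O oO; exists (e @` O); first exact: eo.
  by rewrite setTI; apply/esym/setIidPr => _ [x Ox <-]; exists x.
Qed.

(** The point [t0] is only the default value off the range. Continuity is available at points of the
    range alone, which is why later statements ask for continuity pointwise. *)
Lemma embedding_inv (t0 : T) : embedding e -> open (range e) ->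
  exists g : U -> T, cancel e g /\ forall t, {for e t, continuous g}.
Proof.
move=> ee oe.
have /choice [g gP] : forall u, exists t, range e u -> e t = u.
  by move=> u; have [[t _ <-]|nu] := pselect (range e u); [exists t|exists t0].
have gK : cancel e g by move=> t; apply: (embedding_inj ee); apply: gP; exists t.
exists g; split=> // t N; rewrite /= gK nbhsE => -[O [oO Ot] ON].
have : nbhs (e t) (e @` O).
  by apply: open_nbhs_sub; [exact: embedding_image_open|exists t].
by apply: filterS => _ [z Oz <-]; apply: ON; rewrite gK.
Qed.

End embeddings.

Lemma set_val_continuous (T : topologicalType) (A : set T) :
  continuous (set_val : set_type A -> T).
Proof. exact: initial_continuous. Qed.

Lemma range_set_val (T : Type) (A : set T) : range (set_val : A -> T) = A.
Proof.
apply/seteqP; split=> [_ [x _ <-]|x Ax]; first exact: set_valP.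
by exists (exist _ x (mem_set Ax)).
Qed.

Lemma set_val_embedding (T : topologicalType) (A : set T) :
  embedding (set_val : A -> T).
Proof.
split.
- by split=> [x _|x y _ _|]; [exists x|exact: val_inj|].
- exact/continuous_subspaceT/set_val_continuous.
- move=> _ [V oV <-]; exists V => //; rewrite setTI.
  apply/seteqP; split=> [_ [x Vx <-]|_ [[x _ <-] Vx]]; last by exists x.
  by split=> //; exists x.
Qed.

Section portly_sets.
Variables (T : topologicalType).

(** A nonempty relatively clopen piece of the trace of [E] on [U] meets the dense set [D], hence
    contains the connected trace of [D]. The complementary piece would be cut out by an open set
    that misses [D], so it is empty. *)
Lemma portlyS (D E : set T) : portly D -> D `<=` E -> open E -> portly E.
Proof.
move=> [oD dD cD] DE oE; split=> // [O O0 oO|U oU cU].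
  by have [x [Ox Dx]] := dD O O0 oO; exists x; split=> //; exact: DE.
move=> B [b Bb] [O oO BO] [C cC BC].
have UO : U `&` E `&` O `<=` C by rewrite -BO BC => x [].
have UC : U `&` E `&` C `<=` O by rewrite -BC BO => x [].
have UDO : U `&` D `<=` O.
  apply: (connected_clopen (cD U oU cU)).
  - have [z [[[Uz _] Oz] Dz]] : (U `&` E `&` O) `&` D !=set0.
      by apply: dD; [exists b; rewrite -BO|do 2 apply: openI => //].
    by exists z.
  - by move=> x _ Ox; apply: filterS (open_nbhs_sub oO Ox) => z Oz _.
  - move=> x [Ux Dx] nOx; have : nbhs x (~` C).
      apply: open_nbhs_sub; first exact: closed_openC.
      by move=> Cx; apply: nOx; apply: UC; split=> //; split=> //; exact: DE.
    apply: filterS => z nCz [Uz Dz] Oz; apply: nCz; apply: UO.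
    by split=> //; split=> //; exact: DE.
rewrite BC; apply/setIidPl => x [Ux Ex]; apply: contrapT => nCx.
have [z [[Uz nCz] Dz]] : (U `&` ~` C) `&` D !=set0.
  by apply: dD; [exists x|apply: openI => //; exact: closed_openC].
apply: nCz; apply: UO; split; first by split=> //; exact: DE.
exact: UDO.
Qed.

Lemma portlyI (D E : set T) : portly D -> portly E -> portly (D `&` E).
Proof.
move=> [oD dD cD] [oE dE cE]; split; [exact: openI|exact: denseI|].
by move=> U oU cU; rewrite setIA; apply: cE; [exact: openI|exact: cD].
Qed.

Lemma portly_connected (D : set T) : portly D -> connected [set: T] ->
  connected D.
Proof. by move=> [_ _ cD] cT; rewrite -(setTI D); apply: cD => //; exact: openT. Qed.

End portly_sets.

Section spread_base.
Variables (R : realType) (X Y : topologicalType) (p : X -> Y).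

(** The subbasis of components is in fact locally a basis: given finitely many components containing
    [x], take a connected [U] inside all the open sets they lie over; the component of [x] over [U]
    is contained in each of them. *)
Lemma spread_base x N : spread R p -> nbhs x N ->
  exists U, [/\ open U, U (p x), connected U &
    connected_component (p @^-1` U) x `<=` N].
Proof.
move=> [aX aY cp [_ /(_ x) bx]] /bx[_ [[F FC <-] Fx] FN].
have /choice [V VP] : forall C : set X, exists V, C \in F ->
    nbhs (p x) V /\ connected_component (p @^-1` V) x `<=` C.
  move=> C; have [CF|] := boolP (C \in F); last by exists setT.
  have /set_mem [V oV [z Vz CE]] := FC C CF; exists V => _.
  have Cx : C x by exact: Fx.
  split; first by apply: open_nbhs_sub => //; move: Cx; rewrite CE => /connected_component_sub.
  by move: Cx; rewrite CE => /same_connected_component ->.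
have Vpx : nbhs (p x) (\bigcap_(C in [set` F]) V C).
  by apply: filter_bigI => C CF; have [] := VP C CF.
have [U [oU Upx UV cU]] := admissible_locally_connected aY Vpx.
exists U; split=> // z Cz; apply: FN => C CF; have [_] := VP C CF; apply.
apply: connected_component_max Cz.
- by apply: connected_component_refl.
- by move=> w /connected_component_sub Uw; exact: UV.
- exact: component_connected.
Qed.

Lemma spread_of_base : admissible_space R X -> admissible_space R Y ->
  continuous p ->
  (forall x N, nbhs x N -> exists U, [/\ open U, U (p x) &
    connected_component (p @^-1` U) x `<=` N]) ->
  spread R p.
Proof.
move=> aX aY cp base; split=> //; split.
  move=> _ [F FC <-]; apply: open_of_nbhs_sub => x Fx.
  apply: filter_bigI => C CF; apply: open_nbhs_sub; last exact: Fx.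
  have /set_mem [V oV [z Vz ->]] := FC C CF.
  apply: component_open; first exact: admissible_locally_connected aX.
  exact: open_preimage.
move=> x N /base[U [oU Ux UN]].
exists (connected_component (p @^-1` U) x) => //; split.
  by apply: finI_from1; exists U => //; exists x.
exact: connected_component_refl.
Qed.

End spread_base.

Section open_subspace.
Variables (R : realType) (W X : topologicalType) (j : W -> X).
Hypotheses (ej : embedding j) (oj : open (range j)).

Lemma embedding_nbhs w N : nbhs w N -> nbhs (j w) (j @` N).
Proof.
rewrite nbhsE => -[O [oO Ow] ON]; rewrite nbhsE; exists (j @` O).
  by split; [exact: embedding_image_open|exists w].
exact: image_subset.
Qed.

Lemma embedding_admissible : admissible_space R X -> admissible_space R W.
Proof.
move=> [hX lX fX]; have jc := embedding_continuous ej.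
have jinj := embedding_inj ej; split.
- move=> w w' ww'; apply/jinj/hX => A B /jc wA /jc w'B.
  by have [z [Az Bz]] := ww' _ _ wA w'B; exists (j z).
- split=> [U []//|w N /embedding_nbhs wN].
  have [V [oV Vw VN pV]] := lpc_basis lX wN.
  have [g [gK gc]] := embedding_inv w ej oj.
  exists (j @^-1` V); last first.
    by move=> z /= /VN [z' Nz' /jinj <-].
  split=> //; split; first exact: open_preimage.
  move=> x y Vx Vy; have [a aV] := pV _ _ Vx Vy.
  have ja t : j (g (a t)) = a t.
    have Va : V (a t) by apply: aV; exists t.
    by have [z _ <-] := VN _ Va; rewrite gK.
  have gac : continuous (g \o a).
    by move=> t; apply: continuous_comp; [exact: cts_fun|rewrite -ja; exact: gc].
  have ga0 : (g \o a) zero = x by rewrite /= path_zero gK.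
  have ga1 : (g \o a) one = y by rewrite /= path_one gK.
  exists (mk_path gac ga0 ga1) => _ [t _ <-] /=.
  by rewrite /mk_path /= ja; apply: aV; exists t.
- move=> w; have [B [cB Bn BX]] := fX (j w).
  exists [set j @^-1` b | b in B]; split.
  + exact: card_le_trans (card_image_le _ _) cB.
  + by move=> _ [b /Bn nb <-]; exact: jc.
  + move=> N /embedding_nbhs /BX [b Bb bN].
    by exists (j @^-1` b); [exists b|move=> z /= /bN [z' Nz' /jinj <-]].
Qed.

Lemma embedding_spread (Y : topologicalType) (p : X -> Y) :
  spread R p -> spread R (p \o j).
Proof.
move=> sp; have [aX aY cp _] := sp; have jc := embedding_continuous ej.
apply: spread_of_base => //; first exact: embedding_admissible.
  by move=> w; apply: (@continuous_comp _ _ _ j p); [exact: jc|exact: cp].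
move=> w N /embedding_nbhs /(spread_base sp) [U [oU Uw cU UN]].
exists U; split=> // z Cz.
have : (j @` N) (j z); last by move=> [z' Nz' /(embedding_inj ej) <-].
apply: UN; exists (j @` connected_component ((p \o j) @^-1` U) w); last by exists z.
split.
- by exists w => //; exact: connected_component_refl.
- by move=> _ [x /connected_component_sub Ux <-].
- by apply: image_connected; [move=> x _; exact: jc|exact: component_connected].
Qed.

End open_subspace.

(** * Extension to completions *)

Lemma spread_extension (R : realType) (W T X Y : topologicalType) (e : W -> T)
    (pT : T -> Y) (f : W -> X) (p : X -> Y) :
  embedding e -> portly (range e) -> spread R pT -> complete_spread R p ->
  continuous f -> p \o f = pT \o e ->
  exists F : T -> X, [/\ continuous F, F \o e = f & p \o F = pT].
Proof.
move=> ee [oe de le] [aT _ cT _] [sp complete] fc pf.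
have [aX aY cp _] := sp; have [hX _ _] := aX; have [hY _ _] := aY.
have lT := admissible_locally_connected aT.
have lX := admissible_locally_connected aX.
have lY := admissible_locally_connected aY.
pose C t U := connected_component (pT @^-1` U) t.
have CU t U : C t U `<=` pT @^-1` U by exact: connected_component_sub.
have pfE w : p (f w) = pT (e w) by exact: (congr1 (fun k => k w) pf).
(* [chi t U] is the component of [p @^-1` U] that contains the image of the dense
   part near [t]; completeness then provides the value at [t]. *)
pose chi t U := [set x | exists2 w, C t U (e w) &
  connected_component (p @^-1` U) (f w) x].
have Copen t U : open U -> open (C t U).
  by move=> oU; apply: component_open => //; exact: open_preimage.
have Ce t U : open U -> U (pT t) -> exists w, C t U (e w).
  move=> oU Ut; have [z [Cw [w _ we]]] : C t U `&` range e !=set0.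
    apply: de; last exact: Copen.
    by exists t; exact: connected_component_refl.
  by exists w; rewrite we.
have chiE t U w : open U -> C t U (e w) ->
    chi t U = connected_component (p @^-1` U) (f w).
  move=> oU Cw; apply/seteqP; split=> [x [w' Cw']|x wx]; last by exists w.
  have [g [gK gc]] := embedding_inv w ee oe.
  have fgc z : (C t U `&` range e) z -> {for z, continuous (f \o g)}.
    by move=> [_ [w0 _ <-]]; apply: continuous_comp; [exact: gc|exact: fc].
  (* Here local connectedness of the dense part is used: its trace on the component [C t U] is
     connected, so [f] sends it into a single component over [U], whichever [w] is chosen. *)
  suff /same_connected_component -> :
    connected_component (p @^-1` U) (f w) (f w') by [].
  exists ((f \o g) @` (C t U `&` range e)).
    split.
    - by exists (e w); [split=> //; exists w|rewrite /= gK].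
    - move=> _ [z [Cz [w0 _ zE]] <-] /=; rewrite -zE gK pfE zE.
      exact: (CU t).
    - apply: image_connected => //; apply: le; first exact: Copen.
      exact: component_connected.
  by exists (e w'); [split=> //; exists w'|rewrite /= gK].
have chi_comp t U : connected_open_nbhs (pT t) U ->
    is_component (p @^-1` U) (chi t U).
  move=> [[oU Ut] _]; have [w Cw] := Ce t U oU Ut.
  exists (f w); last exact: chiE.
  by rewrite /= pfE; exact: (CU _ _ _ Cw).
have chi_mono t U V : U `<=` V -> chi t U `<=` chi t V.
  move=> UV x [w [A [At AU cA] Aw] [B [Bw BU cB] Bx]].
  by exists w; [exists A|exists B] => //; split=> // z; [move/AU|move/BU];
    exact: UV.
have clos t : closure (range p) (pT t).
  move=> N /cT Nt; move: Nt; rewrite nbhsE => -[O [oO Ot] ON].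
  have [z [Ow [w _ wz]]] : O `&` range e !=set0 by apply: de => //; exists t.
  by exists (pT z); split; [exists (f w); rewrite // pfE wz|exact: ON].
have /choice [F FP] : forall t, exists x, forall U,
    connected_open_nbhs (pT t) U -> chi t U x.
  move=> t; have [x xP] := complete _ (clos t) (chi t) (@chi_comp t)
    (fun U V _ _ UV => @chi_mono t U V UV).
  by exists x.
(* The value lies over every connected open neighborhood of [pT t], and [Y] is Hausdorff. *)
have pF t : p (F t) = pT t.
  apply/esym/hY => A B tA FB.
  have [U [oU Ut UA cU]] := lY _ _ tA.
  exists (p (F t)); split; last exact: nbhs_singleton.
  by apply: UA; have [w _ /connected_component_sub] : chi t U (F t) by apply: FP.
have chiF t U : open U -> connected U -> U (pT t) ->
    chi t U = connected_component (p @^-1` U) (F t).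
  move=> oU cU Ut; have [w Cw] := Ce t U oU Ut.
  have : chi t U (F t) by exact: FP.
  by rewrite (chiE t U w oU Cw) => /same_connected_component.
exists F; split; last exact/funext.
(* Moving [t'] within [C t U] does not change [chi], so [F] maps all of [C t U] into the component
   of [F t] over [U], and such components form a neighborhood basis. *)
- move=> t N /(spread_base sp) [U [oU]]; rewrite pF => Ut cU UN.
  have : nbhs t (C t U).
    by apply: open_nbhs_sub; [exact: Copen|exact: connected_component_refl].
  apply: filterS => t' Ct'; apply: UN; rewrite -chiF//.
  have -> : chi t U = chi t' U.
    by rewrite /chi /C (same_connected_component Ct').
  by apply: FP; split=> //; split=> //; exact: (CU _ _ _ Ct').
- apply/funext => w; apply: hX => A B FA fB.
  have [U [oU]] := spread_base sp FA; rewrite pF => Ut cU UA.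
  exists (f w); split; last exact: nbhs_singleton.
  apply: UA; rewrite -chiF//; exists w; first exact: connected_component_refl.
  by apply: connected_component_refl; rewrite /= pfE.
Qed.

Section sheet_transfer.
Variables (X Y : topologicalType) (p : X -> Y).
Hypotheses (hX : hausdorff_space X) (lX : locally_connected X).
Hypotheses (lY : locally_connected Y) (cp : continuous p).

(* An evenly covered set stays so in a completion: a section over it through
   the dense part is, by density, an inverse of [p] on a whole component. *)
Lemma dense_sheets (X1 : topologicalType) (e : X1 -> X) U : embedding e ->
  portly (range e) -> sheets (p \o e) U ->
  sheets p U /\ p @^-1` U `<=` range e.
Proof.
move=> ee [oe de le] [oU cU sU]; have ec := embedding_continuous ee.
suff main x : U (p x) -> exists s, [/\ section_on p U s, s (p x) = x,
    connected_component (p @^-1` U) x = s @` U & range e x].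
  split; last by move=> x /main[s []].
  by split=> // x /main[s [? ? ? _]]; exists s.
move=> Ux; pose C := connected_component (p @^-1` U) x.
have oC : open C by apply: component_open => //; exact: open_preimage.
have CU : C `<=` p @^-1` U by exact: connected_component_sub.
have Cx : C x by exact: connected_component_refl.
have [z1 [Cx1 [x1 _ ex1]]] : C `&` range e !=set0 by apply: de => //; exists x.
rewrite -{}ex1 in Cx1.
have [s1 [[ps1 s1c] s1x s1C]] := sU x1 (CU _ Cx1).
have [g [gK gc]] := embedding_inv x1 ee oe.
have retract z : C z -> (e \o s1 \o p) z = z.
  apply: (eq_on_dense hX de oC).
  - move=> w /CU Uw; apply: (@continuous_comp _ _ _ p (e \o s1)); first exact: cp.
    by apply: continuous_comp; [exact: s1c|exact: ec].
  - by move=> w _; exact: cvg_id.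
  - move=> {}z Cw [w _ we]; rewrite -{}we in Cw *.
    have : connected_component ((p \o e) @^-1` U) x1 w.
      exists (g @` (C `&` range e)); last by exists (e w); [split=> //; exists w|].
      split.
      - by exists (e x1); [split=> //; exists x1|].
      - by move=> _ [z' [Cz' [w' _ zE]] <-]; rewrite -zE gK /= zE; exact: CU.
      - apply: image_connected; first by move=> _ [_ [v _ <-]]; exact: gc.
        by apply: le => //; exact: component_connected.
    by rewrite s1C => -[u Uu <-]; have /= -> := ps1 u Uu.
exists (e \o s1).
have sec : section_on p U (e \o s1).
  split=> [u Uu|u Uu]; first exact: ps1.
  by apply: continuous_comp; [exact: s1c|exact: ec].
split=> //; first exact: retract.
- apply/seteqP; split=> [z Cz|_ [u Uu <-]].
    by exists (p z); [exact: CU|exact: retract].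
  have sx : ((e \o s1) @` U) x by exists (p x) => //; exact: retract.
  apply: (connected_component_max sx); last by exists u.
  + by move=> _ [v Uv <-]; rewrite /= sec.1.
  + by apply: image_connected => //; exact: sec.2.
- by exists (s1 (p x)) => //; exact: retract.
Qed.

(** Over an evenly covered set, sections carry density and local connectedness of [D] up to [X], and
    [connectedI_local] assembles the local pieces. Points that are not ordinary are handled by first
    cutting the given open set down to the portly ordinary locus. *)
Lemma portly_preimage (D : set Y) : portly (ordinary p) -> portly D ->
  D `<=` ordinary_base p -> portly (p @^-1` D).
Proof.
move=> [oO dO cO] [oD dD cD] DO.
have oE : open (p @^-1` D) by exact: open_preimage.
have dE : dense (p @^-1` D).
  move=> O O0 oO'; have [x [Ox ordx]] := dO O O0 oO'.
  have [U [Ux _ sU]] := ordinary_sheets lY ordx filterT.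
  have [oU _ /(_ _ Ux) [s [[ps sc] sx _]]] := sU.
  have [u [[Uu Osu] Du]] : (U `&` s @^-1` O) `&` D !=set0.
    apply: dD; last exact: openI_preimage.
    by exists (p x); split=> //=; rewrite sx.
  by exists (s u); split=> //=; rewrite ps.
split=> // W oW cW.
have -> : W `&` p @^-1` D = (W `&` ordinary p) `&` p @^-1` D.
  apply/seteqP; split=> [x [Wx Dx]|x [[Wx _] Dx]] //.
  by split=> //; split=> //; exact: DO.
apply: connectedI_local => //; [exact: openI|exact: cO|].
move=> x [Wx ordx].
have [U [Ux _ sU]] := ordinary_sheets lY ordx filterT.
have [oU cU /(_ _ Ux) [s [[ps sc] sx sC]]] := sU.
have oC := sheet_open lX cp sU Ux sC.
have [V [oV Vx VU cV]] : exists V, [/\ open V, V (p x),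
    V `<=` U `&` s @^-1` (W `&` ordinary p) & connected V].
  apply: lY; apply: open_nbhs_sub.
    by apply: openI_preimage => //; exact: openI.
  by split=> //=; rewrite sx.
exists (s @` U `&` p @^-1` V); split.
- apply: filterI; last exact/cp/open_nbhs_sub.
  by apply: open_nbhs_sub => //; exists (p x).
- by move=> _ [[u Uu <-]] /=; rewrite ps// => /VU [].
- have -> : s @` U `&` p @^-1` V `&` p @^-1` D = s @` (V `&` D).
    apply/seteqP; split=> [_ [[[u Uu <-]] /=]|_ [u [Vu Du] <-]].
      by rewrite ps// => Vu Du; exists u.
    by have [Uu _] := VU _ Vu; rewrite /= ps//; split=> //; split=> //; exists u.
  apply: image_connected; last exact: cD.
  by move=> u [/VU [Uu _] _]; exact: sc.
Qed.

(* A section over [U] meets the portly part, hence sweeps a whole component. *)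
Lemma section_component (D U : set Y) (s : Y -> X) y : portly D ->
  portly (p @^-1` D) -> D `<=` ordinary_base p -> open U -> connected U ->
  section_on p U s -> U y ->
  connected_component (p @^-1` U) (s y) = s @` U.
Proof.
move=> [oD dD cD] [oE dE cE] DO oU cU [ps sc] Uy.
pose C := connected_component (p @^-1` U) (s y).
have oC : open C by apply: component_open => //; exact: open_preimage.
have CU : C `<=` p @^-1` U by exact: connected_component_sub.
have sUC : s @` U `<=` C.
  apply: connected_component_max; first by exists y.
  - by move=> _ [u Uu <-] /=; rewrite ps.
  - exact: image_connected.
apply/seteqP; split=> // z Cz; exists (p z); first exact: CU.
have spc w : C w -> {for w, continuous (s \o p)}.
  by move=> /CU Uw; apply: continuous_comp; [exact: cp|exact: sc].
have [u [Uu Du]] : U `&` D !=set0 by apply: dD => //; exists y.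
have Csu : (C `&` p @^-1` D) (s u).
  by split; [apply: sUC; exists u|rewrite /= ps].
apply: (@eq_on_dense _ _ C (p @^-1` D) (s \o p) id) => //.
  by move=> w _; exact: cvg_id.
move=> w Cw Dw.
apply: (@lift_unique _ _ _ hX lX lY cp _ (C `&` p @^-1` D) (s \o p) id (s u)) => //.
- exact: cE (@component_connected _ _ _).
- by move=> v [Cv _]; exact: spc.
- by move=> v _; exact: cvg_id.
- by move=> v [/CU Uv _]; rewrite /= ps.
- by move=> v [/CU Uv Dv]; rewrite /= ps//; exact: DO.
- by rewrite /= ps.
Qed.

End sheet_transfer.

(** A covering of the subspace [Y1] is evenly covered in the subspace topology; as [Y1] is open, the
    sheets are transported to open sets of [Y]. *)
Lemma covering_sheets (R : realType) (X1 Y : topologicalType) (Y1 : set Y)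
    (p1 : X1 -> set_type Y1) y :
  covering R p1 -> open Y1 -> Y1 y ->
  exists U, [/\ U y, U `<=` Y1 & sheets (set_val \o p1) U].
Proof.
move=> [aX aY cp1 _ ord] oY1 Y1y.
pose y1 : set_type Y1 := exist _ y (mem_set Y1y).
have ev := @set_val_embedding _ Y1; have vc := embedding_continuous ev.
have ov : open (range (set_val : Y1 -> Y)) by rewrite range_set_val.
have lY1 := admissible_locally_connected aY.
have ordy1 : ordinary_base p1 y1 by rewrite ord.
have [U1 [U1y _ [oU1 cU1 sU1]]] := ordinary_sheets lY1 ordy1 filterT.
have [g [gK gc]] := embedding_inv y1 ev ov.
exists (set_val @` U1); split.
- by exists y1.
- by move=> _ [u _ <-]; exact: set_valP.
have pre : (set_val \o p1) @^-1` (set_val @` U1) = p1 @^-1` U1.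
  apply/seteqP; split=> x /=; last by move=> U1x; exists (p1 x).
  by move=> [u U1u /(embedding_inj ev) <-].
split.
- exact: embedding_image_open.
- by apply: image_connected => // u _; exact: vc.
rewrite pre => x [u U1u /(embedding_inj ev) ux].
have [|s [[ps sc] sx sC]] := sU1 x; first by rewrite -ux.
exists (s \o g); split.
- split=> [_ [v U1v <-]|_ [v U1v <-]]; first by rewrite /= gK ps.
  by apply: continuous_comp; [exact: gc|rewrite gK; exact: sc].
- by rewrite /= gK.
- rewrite sC; apply/seteqP; split=> [_ [v U1v <-]|_ [_ [v U1v <-] <-]].
    by exists (set_val v); [exists v|rewrite /= gK].
  by exists v; rewrite //= gK.
Qed.

(** * Maps out of the universal spread *)

(** By [dense_sheets], everything over an evenly covered set already comes from the covering, so the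
    completion adds points only outside [Y1]. *)
Lemma completion_covering (R : realType) (X1 X Y : topologicalType)
    (Y1 : set Y) (p1 : X1 -> set_type Y1) (i : X1 -> X) (p : X -> Y) :
  covering R p1 -> open Y1 -> spread R p -> embedding i ->
  p \o i = set_val \o p1 -> portly (range i) ->
  Y1 `<=` ordinary_base p /\ range i = p @^-1` Y1.
Proof.
move=> c1 oY1 [aX aY cp _] ei pi pri.
have [hX _ _] := aX; have lX := admissible_locally_connected aX.
have sheetsY1 y : Y1 y ->
    exists U, [/\ U y, U `<=` Y1, sheets p U & p @^-1` U `<=` range i].
  move=> /(covering_sheets c1 oY1) [U [Uy UY1]]; rewrite -pi => sU.
  by have [spU pU] := dense_sheets hX lX cp ei pri sU; exists U.
split=> [y /sheetsY1[U [Uy _ sU _]]|]; first exact: sheets_ordinary sU Uy.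
apply/seteqP; split=> [_ [x _ <-]|x /= /sheetsY1[U [Ux _ _ /(_ _ Ux)]]] //.
have /(congr1 (fun k => k x)) /= -> := pi; exact: set_valP.
Qed.

Section deck_maps.
Variables (X Y : topologicalType) (p : X -> Y).

Lemma deck_continuous (g : deck p) : continuous g.
Proof. by have /homeomorphismP[g' []] := deck_homeo g. Qed.

Lemma deck_fiber (g : deck p) x : p (g x) = p x.
Proof. exact: (congr1 (fun k => k x) (deck_over g)). Qed.

End deck_maps.

Section universal_spread.
Variables (R : realType) (Y Yt : topologicalType) (pt : Yt -> Y) (D : set Y).
Hypotheses (csp : complete_spread R pt) (pD : portly D).
Hypotheses (Dpt : D `<=` ordinary_base pt) (pDt : portly (pt @^-1` D)).
Hypothesis cYt : connected [set: Yt].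
Hypothesis surj_pt : forall y, D y -> exists z, pt z = y.
(** The only form in which simple connectedness enters this section. *)
Hypothesis universal : forall (X : topologicalType) (p : X -> Y),
  complete_spread R p -> D `<=` ordinary_base p ->
  forall z x, D (pt z) -> pt z = p x ->
  exists F : Yt -> X, [/\ continuous F, p \o F = pt & F z = x].

Let aYt : admissible_space R Yt. Proof. by have [[]] := csp. Qed.
Let aY : admissible_space R Y. Proof. by have [[]] := csp. Qed.
Let cpt : continuous pt. Proof. by have [[]] := csp. Qed.
Let lYt := admissible_locally_connected aYt.
Let lY := admissible_locally_connected aY.
Let hYt : hausdorff_space Yt. Proof. by have [] := aYt. Qed.

Lemma ordinary_portly : portly (ordinary pt).
Proof.
apply: (portlyS pDt); first by move=> z /Dpt.
apply: open_of_nbhs_sub => z zO.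
have [U [Uz _ sU]] := ordinary_sheets lY zO filterT.
have : nbhs z (pt @^-1` U).
  by apply: cpt; apply: open_nbhs_sub => //; case: sU.
by apply: filterS => w; exact: sheets_ordinary sU.
Qed.

Section target.
Variables (X : topologicalType) (p : X -> Y).
Hypotheses (sp : spread R p) (Dp : D `<=` ordinary_base p).

Let aX : admissible_space R X. Proof. by have [] := sp. Qed.
Let cp : continuous p. Proof. by have [] := sp. Qed.
Let lX := admissible_locally_connected aX.
Let hX : hausdorff_space X. Proof. by have [] := aX. Qed.

(* Stated over a portly [E] smaller than [D] because the deck maps of a
   quasi-Galoisian covering are only available over some other portly set. *)
Lemma map_unique_on (E : set Y) (F G : Yt -> X) z0 : portly E -> E `<=` D ->
  (forall z, E (pt z) -> {for z, continuous F}) ->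
  (forall z, E (pt z) -> {for z, continuous G}) ->
  (forall z, E (pt z) -> p (F z) = pt z) ->
  (forall z, E (pt z) -> p (G z) = pt z) -> E (pt z0) -> F z0 = G z0 ->
  forall z, E (pt z) -> F z = G z.
Proof.
move=> pE ED Fc Gc pF pG Ez0 FG0.
have cE : connected (pt @^-1` E).
  apply: portly_connected cYt; apply: portly_preimage => //.
    exact: ordinary_portly.
  by move=> y /ED/Dpt.
apply: (lift_unique hX lX lY cp cE _ _ _ _ Ez0 FG0) => // z Ez.
  by rewrite pF// pG.
by rewrite pF//; exact/Dp/ED.
Qed.

Lemma map_eq_on_dense (E : set Y) (F G : Yt -> X) : portly E -> E `<=` D ->
  continuous F -> continuous G ->
  (forall z, E (pt z) -> F z = G z) -> F = G.
Proof.
move=> pE ED Fc Gc FG; apply/funext => z.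
have [_ dE _] : portly (pt @^-1` E).
  apply: portly_preimage => //; first exact: ordinary_portly.
  by move=> y /ED/Dpt.
by apply: (eq_on_dense hX dE openT) => // w _; [exact: Fc|exact: Gc|exact: FG].
Qed.

Lemma map_unique (F G : Yt -> X) z0 : continuous F -> continuous G ->
  p \o F = pt -> p \o G = pt -> D (pt z0) -> F z0 = G z0 -> F = G.
Proof.
move=> Fc Gc pF pG Dz0 FG0; apply: (map_eq_on_dense pD) => //.
apply: (map_unique_on pD _ _ _ _ _ Dz0 FG0) => // z _.
- exact: Fc.
- exact: Gc.
- exact: (congr1 (fun k => k z) pF).
- exact: (congr1 (fun k => k z) pG).
Qed.

End target.

(** Maps over [Y] sending [z] to [z'] and [z'] to [z] are mutually inverse, since their composites
    fix a point over [D] and are therefore the identity. *)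
Lemma deck_transitive z z' : D (pt z) -> pt z = pt z' ->
  exists g : deck pt, g z = z'.
Proof.
move=> Dz zz'; have [sp _] := csp.
have [F [Fc pF Fz]] := universal csp Dpt Dz zz'.
have Dz' : D (pt z') by rewrite -zz'.
have [G [Gc pG Gz']] := universal csp Dpt Dz' (esym zz').
have comp_c (A B : Yt -> Yt) : continuous A -> continuous B -> continuous (A \o B).
  by move=> Ac Bc t; apply: continuous_comp; [exact: Bc|exact: Ac].
have idc : continuous (@id Yt) by move=> t; exact: cvg_id.
have GF : G \o F = id.
  apply: (map_unique sp Dpt (comp_c _ _ Gc Fc) idc _ _ Dz) => //.
    by rewrite compA pG.
  by rewrite /= Fz.
have FG : F \o G = id.
  apply: (map_unique sp Dpt (comp_c _ _ Fc Gc) idc _ _ Dz') => //.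
    by rewrite compA pF.
  by rewrite /= Gz'.
have hF : homeomorphism F.
  apply/homeomorphismP; exists G; split=> // t.
    exact: (congr1 (fun k => k t) GF).
  exact: (congr1 (fun k => k t) FG).
by exists (Deck hF pF).
Qed.

Section map_onto.
Variables (X : topologicalType) (p : X -> Y).
Hypotheses (sp : spread R p) (Dp : D `<=` ordinary_base p).
Hypothesis pDX : portly (p @^-1` D).
Variable F : Yt -> X.
Hypotheses (Fc : continuous F) (pF : p \o F = pt).

Let aX : admissible_space R X. Proof. by have [] := sp. Qed.
Let cp : continuous p. Proof. by have [] := sp. Qed.
Let lX := admissible_locally_connected aX.
Let hX : hausdorff_space X. Proof. by have [] := aX. Qed.
Let pFE z : p (F z) = pt z. Proof. exact: (congr1 (fun k => k z) pF). Qed.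

(** Pushing a section of [pt] forward along [F] gives a section of [p], which sweeps a component by
    [section_component]. The set [U] is not assumed to be evenly covered by [p]. *)
Lemma map_component U s z : open U -> connected U -> U (pt z) ->
  section_on pt U s -> s (pt z) = z ->
  connected_component (p @^-1` U) (F z) = (F \o s) @` U.
Proof.
move=> oU cU Uz [ps sc] sz.
have := @section_component _ _ p hX lX lY cp D U (F \o s) (pt z) pD pDX Dp oU cU.
rewrite /= sz; apply=> //; split=> u Uu; first by rewrite /= pFE ps.
by apply: continuous_comp; [exact: sc|exact: Fc].
Qed.

(** Over small [U], a component that meets the range of [F] is contained in it, so the range is
    relatively clopen in the connected set over [D]. *)
Lemma map_surj x : connected [set: X] -> D (p x) -> exists z, F z = x.
Proof.
move=> cX Dx.
have component_range y : D y -> exists U, [/\ open U, U y &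
    forall z, U (pt z) -> connected_component (p @^-1` U) (F z) `<=` range F].
  move=> Dy; have [U [Uy _ [oU cU sU]]] := ordinary_sheets lY (Dpt Dy) filterT.
  exists U; split=> // z Uz; have [s [sec sz _]] := sU z Uz.
  rewrite (map_component oU cU Uz sec sz) => _ [u _ <-]; exact: imageT.
suff /(_ x Dx) [z _ <-] : p @^-1` D `<=` range F by exists z.
apply: connected_clopen; first exact: portly_connected.
- have [z zx] := surj_pt Dx.
  by exists (F z); split; [rewrite /= pFE zx|exists z].
- move=> x' Dx' [z _ zx']; have [U [oU Ux' Ur]] := component_range _ Dx'.
  have Uz : U (pt z) by rewrite -pFE zx'.
  have : nbhs x' (connected_component (p @^-1` U) x').
    apply: open_nbhs_sub; last exact: connected_component_refl.
    by apply: component_open => //; exact: open_preimage.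
  by apply: filterS => w; rewrite -zx' => /(Ur z Uz) Fw _.
- move=> x' Dx' nx'; have [U [oU Ux' Ur]] := component_range _ Dx'.
  have : nbhs x' (connected_component (p @^-1` U) x').
    apply: open_nbhs_sub; last exact: connected_component_refl.
    by apply: component_open => //; exact: open_preimage.
  apply: filterS => w x'w _ [z _ zw]; apply: nx'; apply: (Ur z).
    by move: x'w => /connected_component_sub; rewrite /= -zw pFE.
  by rewrite zw; exact: connected_component_sym.
Qed.

Lemma map_open z O : ordinary_base pt (pt z) -> nbhs z O ->
  nbhs (F z) (F @` O).
Proof.
move=> zO Oz.
have [U [Uz _ [oU cU sU]]] := ordinary_sheets lY zO filterT.
have [s [[ps sc] sz _]] := sU z Uz.
have [V [oV Vz VU cV]] : exists V, [/\ open V, V (pt z),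
    V `<=` U `&` s @^-1` O & connected V].
  apply: lY; apply: filterI; first exact: open_nbhs_sub.
  by apply: sc => //; rewrite sz.
have secV : section_on pt V s.
  by split=> u /VU[Uu _]; [exact: ps|exact: sc].
have : nbhs (F z) (connected_component (p @^-1` V) (F z)).
  apply: open_nbhs_sub; last by apply: connected_component_refl; rewrite /= pFE.
  by apply: component_open => //; exact: open_preimage.
rewrite (map_component oV cV Vz secV sz).
by apply: filterS => _ [u /VU[_ Ou] <-]; exists (s u).
Qed.

(** Transitivity of the deck group is known only over [D], whereas [z] is merely ordinary. The
    sheets through [z] and [z'] are followed to a point [u] over [D], a deck map is taken there, and
    unique lifting along the sheet brings it back to [z] and [z']. *)
Lemma map_fiber z z' : ordinary_base pt (pt z) -> F z = F z' ->
  exists g : deck pt, F \o g = F /\ g z = z'.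
Proof.
move=> zO FF; have zz' : pt z = pt z' by rewrite -!pFE FF.
have [U [Uz _ sU]] := ordinary_sheets lY zO filterT.
have [oU cU secU] := sU.
have [s [sec sz _]] := secU z Uz.
have Uz' : U (pt z') by rewrite -zz'.
have [s' [sec' sz' _]] := secU z' Uz'.
(* The images of both sheets under [F] are the component of [F z], which meets each fiber over [U]
   exactly once because it is swept by a section. *)
have FsE u : U u -> F (s u) = F (s' u).
  move=> Uu.
  have : ((F \o s') @` U) (F (s u)).
    rewrite -(map_component oU cU Uz' sec' sz') -FF.
    by rewrite (map_component oU cU Uz sec sz); exists u.
  move=> [v Uv /= vu]; have := congr1 p vu.
  by rewrite !pFE sec'.1// sec.1// => vE; rewrite -vE in vu *.
have [u [Uu Du]] : U `&` D !=set0.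
  by case: pD => _ dD _; apply: dD => //; exists (pt z).
have [g gsu] : exists g : deck pt, g (s u) = s' u.
  by apply: deck_transitive; rewrite sec.1// sec'.1.
have gc := deck_continuous (g := g).
exists g; split.
  apply: (@map_unique _ _ sp Dp _ _ (s u)) => //.
  - by move=> t; apply: continuous_comp; [exact: gc|exact: Fc].
  - by rewrite compA pF; exact: deck_over.
  - by rewrite sec.1.
  - by rewrite /= gsu FsE.
rewrite -sz -sz' zz'.
apply: (@lift_unique _ _ _ hYt lYt lY cpt _ U (g \o s) s' u) => // [v Uv|v Uv|v Uv|v Uv].
- by apply: continuous_comp; [exact: sec.2|exact: gc].
- exact: sec'.2.
- by rewrite /= deck_fiber sec.1// sec'.1.
- by rewrite /= deck_fiber sec.1//; exact: sheets_ordinary sU Uv.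
Qed.

End map_onto.
End universal_spread.

(** * Orbit spaces *)

Section stabilizer.
Variables (X Y Yt : topologicalType) (pt : Yt -> Y) (F : Yt -> X).

Definition stabilizer : {pred deck pt} := [pred g : deck pt | `[< F \o g = F >]].

Lemma stabilizerP (g : deck pt) : reflect (F \o g = F) (g \in stabilizer).
Proof. exact: asboolP. Qed.

Fact stabilizer_mul : mulg_closed stabilizer.
Proof.
move=> g h /stabilizerP Fg /stabilizerP Fh; apply/stabilizerP.
by rewrite -[RHS]Fh -[in RHS]Fg.
Qed.

Fact stabilizer_one : 1%g \in stabilizer.
Proof. exact/stabilizerP. Qed.

Fact stabilizer_inv : invg_closed stabilizer.
Proof.
move=> g /stabilizerP Fg; apply/stabilizerP; apply/funext => z /=.
by rewrite -[in LHS]Fg /=; congr F; exact: deck_invK.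
Qed.

HB.instance Definition _ :=
  isMulClosed.Build (deck pt) stabilizer stabilizer_mul.
HB.instance Definition _ :=
  isMul1Closed.Build (deck pt) stabilizer stabilizer_one.
HB.instance Definition _ :=
  isInvClosed.Build (deck pt) stabilizer stabilizer_inv.

Definition stabilizer_group : groupClosed (deck pt) := stabilizer.

End stabilizer.

Section orbit_map.
Variables (X Y Yt : topologicalType) (pt : Yt -> Y) (H : groupClosed (deck pt)).
Variable F : Yt -> X.
Local Notation Ord := (set_type (ordinary pt)).
Local Notation Q := (orbit_space H).

Lemma orbit_pi_eq (x x' : Ord) : \pi_Q x = \pi_Q x' <->
  exists2 g : deck pt, g \in H & g (set_val x) = set_val x'.
Proof.
split=> [/eqmodP /asboolP //|gx]; apply/eqmodP; exact/asboolP.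
Qed.

Definition orbit_map (c : Q) : X := F (set_val (repr c)).

Lemma orbit_mapE (x : Ord) : (forall g : deck pt, g \in H -> F \o g = F) ->
  orbit_map (\pi_Q x) = F (set_val x).
Proof.
move=> HF; rewrite /orbit_map; case: piP => y /orbit_pi_eq[g /HF Fg <-].
exact: (congr1 (fun k => k (set_val x)) Fg).
Qed.

End orbit_map.

Lemma orbit_completion (R : realType) (X Y Yt : topologicalType)
    (pt : Yt -> Y) (p : X -> Y) (F : Yt -> X) (D : set Y) :
  complete_spread R p -> continuous F -> p \o F = pt ->
  open (ordinary pt) -> D `<=` ordinary_base pt -> portly (p @^-1` D) ->
  (forall x, D (p x) -> exists z, F z = x) ->
  (forall z O, ordinary_base pt (pt z) -> nbhs z O -> nbhs (F z) (F @` O)) ->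
  (forall z z', ordinary_base pt (pt z) -> F z = F z' ->
     exists g : deck pt, F \o g = F /\ g z = z') ->
  is_completion R (@orbit_proj _ _ _ (@stabilizer_group X Y Yt pt F)) p.
Proof.
move=> cp Fc pF oO DO pDX Fsurj Fopen Ffib; have [sp _] := cp.
set H := stabilizer_group pt F.
have HF (g : deck pt) : g \in H -> F \o g = F by move/stabilizerP.
pose j := @orbit_map _ _ _ pt H F.
have jE x : j (\pi_(orbit_space H) x) = F (set_val x) by exact: orbit_mapE.
have ov : open (range (set_val : ordinary pt -> Yt)) by rewrite range_set_val.
have ej : embedding j.
  apply: open_embedding.
  - move=> c c'; rewrite -[c]reprK -[c']reprK !jE => FF.
    have [|g [gF gc]] := Ffib _ _ _ FF; first exact: (set_valP (repr c)).
    by apply/orbit_pi_eq; exists g => //; exact/stabilizerP.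
  - apply/quotient_continuous.
    have -> : j \o \pi_(orbit_space H) = F \o set_val by apply/funext => x; exact: jE.
    move=> x; apply: (@continuous_comp _ _ _ (set_val : ordinary pt -> Yt) F);
      last exact: Fc.
    exact: set_val_continuous.
  - move=> O oO'; apply: open_of_nbhs_sub => _ [c Oc <-].
    have oV : open (set_val @` (\pi_(orbit_space H) @^-1` O)).
      apply: embedding_image_open => //; first exact: set_val_embedding.
    have Vc : (set_val @` (\pi_(orbit_space H) @^-1` O)) (set_val (repr c)).
      by exists (repr c); rewrite //= reprK.
    have := Fopen _ _ (set_valP (repr c)) (open_nbhs_sub oV Vc).
    by apply: filterS => _ [_ [x Ox <-] <-]; exists (\pi_(orbit_space H) x).
have jX : p @^-1` D `<=` range j.
  move=> x Dx; have [z zx] := Fsurj x Dx.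
  have zO : ordinary pt z by apply: DO; rewrite -pF /= zx.
  by exists (\pi_(orbit_space H) (exist _ z (mem_set zO))); rewrite // jE.
have oj : open (range j).
  apply: open_of_nbhs_sub => _ [c _ <-].
  have := Fopen _ _ (set_valP (repr c)) (open_nbhs_sub oO (set_valP (repr c))).
  apply: filterS => _ [z zO <-].
  by exists (\pi_(orbit_space H) (exist _ z (mem_set zO))); rewrite // jE.
have pj : p \o j = @orbit_proj _ _ _ H.
  by apply/funext => c; exact: (congr1 (fun k => k (set_val (repr c))) pF).
split=> //; first by rewrite -pj; exact: embedding_spread.
by exists j; split=> //; exact: portlyS jX oj.
Qed.

Lemma homeomorphism_inv (T U : topologicalType) (f : T -> U) :
  homeomorphism f -> exists g, [/\ cancel f g, cancel g f & continuous g].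
Proof.
move=> hf; have [[_ finj fsurj] _ _] := hf.
have fT : range f = [set: U] by apply/seteqP; split=> // u /fsurj.
have ef : embedding f by rewrite /embedding fT.
have oTf : open (range f) by rewrite fT; exact: openT.
have /choice [g gK] : forall u, exists t, f t = u.
  by move=> u; have [t _ <-] := fsurj u I; exists t.
have fK : cancel f g by move=> t; apply: (embedding_inj ef).
exists g; split=> // u N /(embedding_nbhs ef oTf); rewrite gK.
by apply: filterS => _ [t Nt <-]; rewrite /= fK.
Qed.

(** The quotient map, followed by the embedding into the completion and the isomorphism with [X], is
    defined on the part over [D]; completeness of [p] extends it to [Yt]. Its fibers over [D] are
    [H]-orbits because the maps after the quotient are injective. *)
Lemma presented_map (R : realType) (X Y Yt : topologicalType)
    (pt : Yt -> Y) (p : X -> Y) (D : set Y) (H : groupClosed (deck pt)) :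
  spread R pt -> complete_spread R p -> open D -> D `<=` ordinary_base pt ->
  portly (pt @^-1` D) -> presented_by R H p ->
  exists F : Yt -> X, [/\ continuous F, p \o F = pt & forall a b, D (pt a) ->
    (F a = F b <-> exists2 h : deck pt, h \in H & h a = b)].
Proof.
move=> spt cp oD DO pDt [X' [p' [[_ _ [j [ej pj _]]] [f hf fp]]]].
have [f' [fK f'K f'c]] := homeomorphism_inv hf.
pose A := pt @^-1` D; pose v := set_val : A -> Yt.
have Av (a : A) : D (pt (v a)) by exact: (set_valP a).
pose inc (a : A) : ordinary pt := exist _ (v a) (mem_set (DO _ (Av a))).
pose phi (a : A) := f' (j (\pi_(orbit_space H) (inc a))).
have inc_c : continuous inc.
  by move=> a; apply: set_type_continuous; exact: set_val_continuous.
have phic : continuous phi.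
  move=> a; apply: (@continuous_comp _ _ _ (j \o \pi_(orbit_space H) \o inc) f');
    last exact: f'c.
  apply: (@continuous_comp _ _ _ (\pi_(orbit_space H) \o inc) j);
    last exact: embedding_continuous.
  apply: (@continuous_comp _ _ _ inc \pi_(orbit_space H)); first exact: inc_c.
  exact: pi_continuous.
have pphi : p \o phi = pt \o v.
  apply/funext => a; rewrite -fp /= /phi f'K.
  have /(congr1 (fun k => k (\pi_(orbit_space H) (inc a)))) /= -> := pj.
  by rewrite orbit_projE.
have ev : embedding v by exact: set_val_embedding.
have pv : portly (range v) by rewrite range_set_val.
have [F [Fc Fphi pF]] := spread_extension ev pv spt cp phic pphi.
exists F; split=> // a b Da.
have FE z (Dz : D (pt z)) : F z = phi (exist _ z (mem_set Dz)).
  by rewrite -Fphi.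
have phi_eq (x y : A) : phi x = phi y <->
    exists2 h : deck pt, h \in H & h (v x) = v y.
  split=> [/(can_inj f'K)/(embedding_inj ej)/orbit_pi_eq//|hxy].
  by congr (f' (j _)); apply/orbit_pi_eq.
split=> [Fab|[h hH hab]].
  have Db : D (pt b) by move: Da; rewrite -pF /= Fab.
  by move: Fab; rewrite (FE a Da) (FE b Db) => /phi_eq.
have Db : D (pt b) by rewrite -hab deck_fiber.
by rewrite (FE a Da) (FE b Db); apply/phi_eq; exists h.
Qed.

(** * Normal subgroups *)

Section restriction.
Variables (R : realType) (X Y : topologicalType) (p : X -> Y) (D : set Y).
Local Notation X1 := (set_type (p @^-1` D)).

Definition restrict (x : X1) : set_type D :=
  exist _ (p (set_val x)) (mem_set (set_valP x)).

Lemma val_restrict : set_val \o restrict = p \o set_val.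
Proof. by []. Qed.

Lemma restrict_covering : spread R p -> open D -> D `<=` ordinary_base p ->
  D `<=` range p -> covering R restrict.
Proof.
move=> [aX aY cp _] oD DO Dp.
have lX := admissible_locally_connected aX.
have lY := admissible_locally_connected aY.
have evX : embedding (set_val : X1 -> X) by exact: set_val_embedding.
have evY : embedding (set_val : D -> Y) by exact: set_val_embedding.
have ovX : open (range (set_val : X1 -> X)).
  by rewrite range_set_val; exact: open_preimage.
have ovY : open (range (set_val : D -> Y)) by rewrite range_set_val.
have aX1 : admissible_space R X1 by exact: embedding_admissible evX ovX aX.
have aD : admissible_space R D by exact: embedding_admissible evY ovY aY.
have vX := embedding_continuous evX; have vY := embedding_continuous evY.
have rc : continuous restrict.
  move=> x; apply: set_type_continuous.
  by apply: (@continuous_comp _ _ _ (set_val : X1 -> X) p); [exact: vX|exact: cp].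
split=> //.
  apply/seteqP; split=> // y _; have [x _ xy] := Dp _ (set_valP y).
  have Dx : (p @^-1` D) x by rewrite /= xy; exact: set_valP.
  by exists (exist _ x (mem_set Dx)) => //; apply: val_inj.
apply/seteqP; split=> // y _.
have [U [Uy UD sU]] :=
  ordinary_sheets lY (DO _ (set_valP y)) (open_nbhs_sub oD (set_valP y)).
have [oU cU secU] := sU.
(* Inverses of the two inclusions ([gY] here, [gX] below) conjugate sections of [p] into sections of
   [restrict]. They are meaningful only on [D] and over [D], where sections over [U] remain. *)
have [gY [gYK gYc]] := embedding_inv y evY ovY.
have vgY u : U u -> set_val (gY u) = u.
  by move=> /UD Du; rewrite -[u]/(set_val (exist _ u (mem_set Du) : D)) gYK.
apply: (@sheets_ordinary _ _ _ rc (set_val @^-1` U)); last exact: Uy.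
split.
- by move: vY => /continuousP; exact.
- have -> : set_val @^-1` U = gY @` U.
    apply/seteqP; split=> [u Uu|_ [u Uu <-]]; last by rewrite /= vgY.
    by exists (set_val u).
  apply: image_connected => // u Uu.
  rewrite -(vgY u Uu); exact: gYc.
move=> x Ux; have [s [[ps sc] sx sC]] := secU (set_val x) Ux.
have [gX [gXK gXc]] := embedding_inv x evX ovX.
have vgX z : (p @^-1` D) z -> set_val (gX z) = z.
  by move=> Dz; rewrite -[z]/(set_val (exist _ z (mem_set Dz) : X1)) gXK.
have Ds u : U u -> (p @^-1` D) (s u) by move=> Uu; rewrite /= ps//; exact: UD.
exists (gX \o s \o set_val).
have sec : section_on restrict (set_val @^-1` U) (gX \o s \o set_val).
  split=> u Uu; first by apply: val_inj; rewrite /= vgX ?ps//; exact: Ds.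
  apply: (@continuous_comp _ _ _ (set_val : D -> Y) (gX \o s)); first exact: vY.
  apply: continuous_comp; first exact: sc.
  by rewrite -(vgX _ (Ds _ Uu)); exact: gXc.
have s1x : (gX \o s \o set_val) (restrict x) = x by rewrite /= sx gXK.
split=> //; apply/seteqP; split=> [z zC|_ [u Uu <-]].
  have : connected_component (p @^-1` U) (set_val x) (set_val z).
    exists (set_val @` connected_component (restrict @^-1` (set_val @^-1` U)) x);
      last by exists z.
    split.
    - by exists x => //; exact: connected_component_refl.
    - by move=> _ [w /connected_component_sub Uw <-].
    - apply: image_connected; last exact: component_connected.
      by move=> w _; exact: vX.
  rewrite sC => -[u Uu su]; have pz : p (set_val z) = u by rewrite -su ps.
  exists (restrict z); first by rewrite -pz in Uu.
  by rewrite -[LHS]/(gX (s (p (set_val z)))) pz su gXK.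
apply: (connected_component_max (B := (gX \o s \o set_val) @` (set_val @^-1` U))).
- by exists (restrict x).
- move=> _ [v Uv <-]; change (U (p (set_val (gX (s (set_val v)))))).
  by rewrite vgX ?ps//; exact: Ds.
- apply: image_connected; first exact: sec.2.
  have -> : set_val @^-1` U = gY @` U.
    apply/seteqP; split=> [v Uv|_ [v Uv <-]]; last by rewrite /= vgY.
    by exists (set_val v).
  by apply: image_connected => // v Uv; rewrite -(vgY v Uv); exact: gYc.
- by exists u.
Qed.

Lemma restrict_connected : open D -> continuous p -> connected (p @^-1` D) ->
  connected [set: X1].
Proof.
move=> oD cp cD; have oE := open_preimage cp oD.
have ev : embedding (set_val : X1 -> X) by exact: set_val_embedding.
have ov : open (range (set_val : X1 -> X)) by rewrite range_set_val.
have [[x _]|nX] := pselect ([set: X1] !=set0); last first.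
  by move=> B [x _]; exfalso; apply: nX; exists x.
have [g [gK gc]] := embedding_inv x ev ov.
have -> : [set: X1] = g @` (p @^-1` D).
  apply/seteqP; split=> // z _; exists (set_val z) => //; exact: (set_valP z).
apply: image_connected => // z Dz.
exact: (gc (exist _ z (mem_set Dz) : X1)).
Qed.

End restriction.

Section normality.
Variables (R : realType) (X Y Yt : topologicalType) (pt : Yt -> Y) (p : X -> Y).
Variables (D : set Y) (H : groupClosed (deck pt)) (F : Yt -> X).
Hypotheses (csp : complete_spread R p) (cX : connected [set: X]).
Hypotheses (pD : portly D) (pDX : portly (p @^-1` D)).
Hypotheses (Dp : D `<=` ordinary_base p) (Dpt : D `<=` ordinary_base pt).
Hypotheses (cpt : continuous pt) (Fc : continuous F) (pF : p \o F = pt).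
Hypothesis Fsurj : forall x, D (p x) -> exists z, F z = x.
Hypothesis Fopen : forall z O, D (pt z) -> nbhs z O -> nbhs (F z) (F @` O).
Hypothesis Ffib : forall a b, D (pt a) ->
  (F a = F b <-> exists2 h : deck pt, h \in H & h a = b).
Hypothesis transitive : forall z z', D (pt z) -> pt z = pt z' ->
  exists g : deck pt, g z = z'.
Hypothesis pt_onto : D `<=` range pt.

Let oD : open D. Proof. by case: pD. Qed.
Let sp : spread R p. Proof. by case: csp. Qed.
Let cp : continuous p. Proof. by case: sp. Qed.
Let pFE z : p (F z) = pt z. Proof. exact: (congr1 (fun k => k z) pF). Qed.
Local Notation X1 := (set_type (p @^-1` D)).

Lemma normal_descends (g : deck pt) a b : normal_subgroup H -> D (pt a) ->
  F a = F b -> F (g a) = F (g b).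
Proof.
move=> nH Da /(Ffib _ Da)[h hH <-]; apply/Ffib; first by rewrite deck_fiber.
(* As [h ^ g] is conjugation with the inverse on the left, this element is [g h g^-1], which sends
   [g a] to [g (h a)]. *)
exists (h ^ g^-1)%g; first exact: nH.
by rewrite conjgE invgK /=; congr (g (h _)); exact: deck_mapK.
Qed.

(** The descent takes place over [D], where [F] is onto and its fibers are orbits. Continuity holds
    because [F] is open there: a neighborhood of [x] consists of images of points near a preimage
    [z], at which [f] is computed by [F \o g]. *)
Lemma descend (g : deck pt) : normal_subgroup H -> exists f : X1 -> X1,
  continuous f /\ forall x z, F z = set_val x -> set_val (f x) = F (g z).
Proof.
move=> nH.
have Dx (x : X1) : D (p (set_val x)) by exact: (set_valP x).
have /choice [f fP] : forall x : X1, exists y : X1,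
    forall z, F z = set_val x -> set_val y = F (g z).
  move=> x; have [z zx] := Fsurj (Dx x).
  have Dz : D (pt z) by rewrite -pFE zx.
  have Dgz : (p @^-1` D) (F (g z)) by rewrite /= pFE deck_fiber.
  exists (exist _ (F (g z)) (mem_set Dgz)) => z' z'x.
  by apply: normal_descends => //; rewrite zx z'x.
exists f; split=> // x; apply: set_type_continuous; move=> N.
have [z zx] := Fsurj (Dx x); have Dz : D (pt z) by rewrite -pFE zx.
rewrite /= (fP x z zx) => Nx.
have gc := deck_continuous (g := g).
have zN : nbhs z ((F \o g) @^-1` N).
  by apply: (@continuous_comp _ _ _ g F); [exact: gc|exact: Fc|].
have xN : nbhs x (set_val @^-1` (F @` ((F \o g) @^-1` N))).
  by apply: set_val_continuous; rewrite -zx; exact: Fopen.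
by apply: filterS xN => x' [z' Nz' z'x']; rewrite /= (fP x' z').
Qed.

Lemma normal_quasi_galoisian : normal_subgroup H -> quasi_galoisian R p.
Proof.
move=> nH; exists D => //; exists X1, (@restrict _ _ p D).
have Drp : D `<=` range p.
  by move=> y /pt_onto[z _ <-]; exists (F z).
split.
- exact: restrict_covering.
- by apply: restrict_connected => //; exact: portly_connected pDX cX.
- move=> x x' xx'; have Dx : D (p (set_val x)) by exact: (set_valP x).
  have [z zx] := Fsurj Dx.
  have [z' zx'] := Fsurj (set_valP x' : D (p (set_val x'))).
  have pzz' : pt z = pt z' by rewrite -!pFE zx zx'; exact: (congr1 set_val xx').
  have Dz : D (pt z) by rewrite -pFE zx.
  have [g gz] := transitive Dz pzz'.
  have [f [fc fP]] := descend g nH.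
  have [f' [f'c f'P]] := descend (g^-1)%g nH.
  have fK : cancel f f'.
    move=> w; have [v vw] := Fsurj (set_valP w : D (p (set_val w))).
    apply: val_inj; rewrite [LHS](f'P _ (g v)) ?(fP w v vw)//.
    by rewrite deck_mapK.
  have f'K : cancel f' f.
    move=> w; have [v vw] := Fsurj (set_valP w : D (p (set_val w))).
    apply: val_inj; rewrite [LHS](fP _ ((g^-1)%g v)) ?(f'P w v vw)//.
    by rewrite deck_invK.
  have hf : homeomorphism f by apply/homeomorphismP; exists f'.
  have fo : @restrict _ _ p D \o f = @restrict _ _ p D.
    apply/funext => w; apply: val_inj => /=.
    have [v vw] := Fsurj (set_valP w : D (p (set_val w))).
    by rewrite (fP w v vw) pFE deck_fiber -vw pFE.
  exists (Deck hf fo); apply: val_inj => /=.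
  by rewrite [LHS](fP x z zx) gz zx'.
- have ev : embedding (set_val : X1 -> X) by exact: set_val_embedding.
  have pv : portly (range (set_val : X1 -> X)) by rewrite range_set_val.
  rewrite val_restrict; split=> //; last by exists set_val.
  by apply: embedding_spread => //; case: pv.
Qed.

End normality.

Lemma quasi_galoisian_normal (R : realType) (X Y Yt : topologicalType)
    (pt : Yt -> Y) (p : X -> Y) (D : set Y) (H : groupClosed (deck pt))
    (F : Yt -> X) :
  complete_spread R pt -> spread R p -> connected [set: Yt] -> portly D ->
  D `<=` ordinary_base p -> D `<=` ordinary_base pt ->
  portly (pt @^-1` D) -> continuous F -> p \o F = pt ->
  (forall a b, D (pt a) ->
    (F a = F b <-> exists2 h : deck pt, h \in H & h a = b)) ->
  quasi_galoisian R p -> normal_subgroup H.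
Proof.
move=> cspt sp cYt pD Dp Dpt pDt Fc pF Ffib.
move=> [Y1 pY1 [X1 [p1 [cov1 _ gal [_ _ [i [ei pi pri]]]]]]] g h hH.
have oY1 : open Y1 by case: pY1.
have [oi _ _] := pri.
have [Y1p rangei] := completion_covering cov1 oY1 sp ei pi pri.
have [spt _] := cspt; have [aYt aY cpt _] := spt.
have pFE z : p (F z) = pt z by exact: (congr1 (fun k => k z) pF).
have piE x : p (i x) = set_val (p1 x) by exact: (congr1 (fun k => k x) pi).
(* Over [Y1] the values of [F] lie in [i(X1)], on which deck maps of [p1] act; over [D] maps to [X]
   are determined by one value. *)
pose E := Y1 `&` D.
have pE : portly E by exact: portlyI.
have ED : E `<=` D by move=> y [].
have pEt : portly (pt @^-1` E).
  apply: portly_preimage => //.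
  - exact: admissible_locally_connected aYt.
  - exact: admissible_locally_connected aY.
  - exact: ordinary_portly cspt Dpt pDt.
  - by move=> y /ED/Dpt.
have [[z0 Ez0]|nE] := pselect (exists z, E (pt z)); last first.
  (* With nothing over [E], density makes [Yt] empty, and all deck maps are equal. *)
  have -> : (h ^ g)%g = h; last by [].
  apply: deck_eqP => z; exfalso; apply: nE.
  have [_ dE _] := pEt.
  have [w [_ Ew]] : [set: Yt] `&` pt @^-1` E !=set0.
    by apply: dE; [exists z|exact: openT].
  by exists w.
have lift z : E (pt z) -> exists x, i x = F z.
  by move=> [Y1z _]; have : range i (F z);
    [rewrite rangei /= pFE|move=> [x _ xz]; exists x].
have [x xz] := lift z0 Ez0.
have [x' xz'] : exists x', i x' = F (g z0) by apply: lift; rewrite deck_fiber.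
have [|phi phix] := gal x x'.
  by apply: val_inj; rewrite -[LHS]piE -[RHS]piE xz xz' !pFE deck_fiber.
have [gi [giK gic]] := embedding_inv x ei oi.
(* The deck map [phi] transported to [X]. It is controlled only on the range of [i], which is why
   the comparison with [F \o g] is made over [E]. *)
pose psi := i \o phi \o gi.
have lift_gi z : E (pt z) -> i (gi (F z)) = F z.
  by move=> /lift[w <-]; rewrite giK.
have gc := deck_continuous (g := g).
have Fg z : E (pt z) -> F (g z) = psi (F z).
  apply: (map_unique_on cspt Dpt pDt cYt sp Dp pE ED
    (F := F \o g) (G := psi \o F) (z0 := z0)) => // [w _|w Ew|w _|w Ew|].
  - by apply: continuous_comp; [exact: gc|exact: Fc].
  - apply: (@continuous_comp _ _ _ F psi); first exact: Fc.
    apply: (@continuous_comp _ _ _ gi (i \o phi)).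
      by rewrite -lift_gi//; exact: gic.
    apply: continuous_comp; first exact: deck_continuous.
    exact: embedding_continuous.
  - by rewrite /= pFE deck_fiber.
  - by rewrite /= piE deck_fiber -piE lift_gi// pFE.
  - by rewrite /= /psi /= -xz giK phix xz'.
have Ehg : E (pt (((h ^ g)%g : deck pt) z0)) by rewrite deck_fiber.
have gE : g (((h ^ g)%g : deck pt) z0) = h (g z0).
  by rewrite conjgE /= [LHS]deck_invK.
have Dz0 := ED _ Ez0.
(* Since [g] after [h ^ g] is [h] after [g], invariance under [h] at [g z0] says that [psi] takes
   equal values at the two points, and [psi] is injective on the range of [i]. *)
have FE : F z0 = F (((h ^ g)%g : deck pt) z0).
  have hg : F (g z0) = F (h (g z0)).
    by apply/Ffib; [rewrite deck_fiber|exists h].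
  move: hg; rewrite -gE !Fg// => /(embedding_inj ei).
  have /homeomorphismP[phi' [phiK _ _ _]] := deck_homeo phi.
  by move=> /(can_inj phiK) /(congr1 i); rewrite !lift_gi.
have [h' h'H h'z] := (Ffib _ _ Dz0).1 FE.
suff <- : h' = (h ^ g)%g by [].
(* Some [h'] in [H] agrees with the conjugate at the single point [z0] over [D], which forces
   equality of the two deck maps. *)
have hh' := map_unique cspt pD Dpt pDt cYt spt Dpt
  (deck_continuous (g := h')) (deck_continuous (g := (h ^ g)%g))
  (deck_over _) (deck_over _) Dz0 h'z.
by apply: deck_eqP => z; rewrite hh'.
Qed.

Theorem theorem2 (R : realType) (Y : topologicalType) (S : set Y)
  (HY : admissible_space R Y) (cY : connected [set: Y]) (HS : skeletal S)
  (slY : semi_locally_simply_connected R (set_type (~` S)))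
  (Z : topologicalType) (q : Z -> set_type (~` S))
  (Hq : universal_covering R q)
  (Yt : topologicalType) (pt : Yt -> Y)
  (Hpt : is_completion R (set_val \o q) pt)
  (X : topologicalType) (p : X -> Y)
  (Hp : branched_covering_over R p S) :
  (exists H : groupClosed (deck pt), presented_by R H p) /\
  (forall H : groupClosed (deck pt), presented_by R H p ->
     (normal_subgroup H <-> quasi_galoisian R p)).
Proof.
have pD : portly (~` S) := HS; have [oD _ _] := pD.
have [covq scZ] := Hq; have [aZ _ _ qT _] := covq.
have [_ cspt [i [ei pi pri]]] := Hpt; have [spt _] := cspt.
have [aYt aY cpt _] := spt.
have [[csp pT [cX _] [ordX _]] ordS] := Hp; have [sp _] := csp.
have [aX _ cp _] := sp.
have lY := admissible_locally_connected aY.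
have [Dpt rangei] := completion_covering covq oD spt ei pi pri.
have pDt : portly (pt @^-1` (~` S)) by rewrite -rangei.
have Dp : ~` S `<=` ordinary_base p.
  by move=> y Dy; apply: contrapT => /ordS.
have pDX : portly (p @^-1` (~` S)).
  by apply: (portly_preimage (admissible_locally_connected aX)).
have dDt : forall z : Yt, exists z', (~` S) (pt z').
  move=> z; have [_ dE _] := pDt.
  have [w [_ Dw]] : [set: Yt] `&` pt @^-1` (~` S) !=set0.
    by apply: dE; [exists z|exact: openT].
  by exists w.
have cYt : connected [set: Yt].
  have -> : [set: Yt] = closure (range i).
    apply/seteqP; split=> // z _ B; rewrite nbhsE => -[O [oO Oz] OB].
    have [w [Ow iw]] : O `&` range i !=set0.
      by case: pri => _ di _; apply: di => //; exists z.
    by exists w; split=> //; exact: OB.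
  apply/connected_closure/image_connected.
    by move=> z _; exact: embedding_continuous.
  by apply: (@path_connected_connected R); case: scZ.
have surj_pt y : (~` S) y -> exists z, pt z = y.
  move=> Dy; have : range q (exist _ y (mem_set Dy)) by rewrite qT.
  by move=> [z _ qz]; exists (i z); rewrite -[LHS]/((pt \o i) z) pi /= qz.
have universal (X' : topologicalType) (p' : X' -> Y) :
    complete_spread R p' -> ~` S `<=` ordinary_base p' ->
    forall z x, (~` S) (pt z) -> pt z = p' x ->
    exists F : Yt -> X', [/\ continuous F, p' \o F = pt & F z = x].
  move=> csp' Dp' z x Dz zx; have [[aX' _ cp' _] _] := csp'.
  have [z1 _ z1z] : range i z by rewrite rangei.
  have [hX' _ _] := aX'; have [_ lZ _] := aZ.
  have kc : continuous (pt \o i).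
    move=> t; apply: continuous_comp; last exact: cpt.
    exact: embedding_continuous.
  have kO t : ordinary_base p' ((pt \o i) t).
    by apply: Dp'; rewrite pi; exact: set_valP.
  have kz : (pt \o i) z1 = p' x by rewrite /= z1z.
  have [f [fc pf fz]] := lift_simply_connected hX'
    (admissible_locally_connected aX') lY cp' scZ lZ kc kO kz.
  have pfi : p' \o f = pt \o i by exact/funext.
  have [F [Fc Ff pF]] := spread_extension ei pri spt csp' fc pfi.
  by exists F; split=> //; rewrite -z1z -fz -Ff.
have trans := deck_transitive cspt pD Dpt pDt cYt universal.
split.
  have [F [Fc pF]] : exists F : Yt -> X, continuous F /\ p \o F = pt.
    have [[z Dz]|nz] := pselect (exists z, (~` S) (pt z)).
      have [x _ xz] : range p (pt z) by rewrite pT.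
      by have [F [Fc pF _]] := universal X p csp Dp z x Dz (esym xz); exists F.
    (* Connected spaces may be empty here; if no point lies over the complement of [S], then [Yt] is
       empty and [F] is the empty map. *)
    have empty (z : Yt) : False by exact/nz/dDt.
    by exists (fun z => False_rect _ (empty z)); split; [move=> z|apply/funext => z];
      case: (empty z).
  (* The space [X] itself serves as the model of the completion. *)
  exists (stabilizer_group pt F), X, p; split; last first.
    exists id => //; apply/homeomorphismP; exists id; split=> // x; exact: cvg_id.
  apply: (@orbit_completion _ _ _ _ _ _ _ (~` S)) => //.
  - by have [] := ordinary_portly cspt Dpt pDt.
  - move=> x; exact (map_surj cspt pD Dpt surj_pt sp Dp pDX Fc pF cX).
  - move=> z O; exact (@map_open _ _ _ _ _ cspt pD _ _ sp Dp pDX _ Fc pF z O).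
  - exact (map_fiber cspt pD Dpt pDt cYt universal sp Dp pDX Fc pF).
move=> H /(presented_map spt csp oD Dpt pDt)[F [Fc pF Ffib]]; split.
  apply: (normal_quasi_galoisian csp cX pD pDX Dp Fc pF _ _ Ffib trans).
  - move=> x; exact (map_surj cspt pD Dpt surj_pt sp Dp pDX Fc pF cX).
  - move=> z O /Dpt; exact (@map_open _ _ _ _ _ cspt pD _ _ sp Dp pDX _ Fc pF z O).
  - by move=> y /surj_pt[z <-]; exists z.
exact: quasi_galoisian_normal cspt sp cYt pD Dp Dpt pDt Fc pF Ffib.
Qed.
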